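(* Let $(Y_t,t\ge0)$ be a supercritical ($b<0$) CBI$(\Psi,\Phi)$ process and assume $\int_0\frac{\Phi(u)}{|\Psi(u)|}\,\mathrm{d}u=\infty$ (divergence near $0$). Then for any positive deterministic function $(\eta(t),t\ge0)$, if $(\eta(t)Y_t,t\ge0)$ converges almost surely as $t\to\infty$, its limit is either $0$ almost surely or $\infty$ almost surely.
   Context: Let $\sigma\ge 0$, $b\in\mathbb R$, $\beta\ge 0$, and let $\pi,\nu$ be $\sigma$-finite measures on $(0,\infty)$ with $\int_0^\infty (z\wedge z^2)\pi(\mathrm{d}z)<\infty$ and $\int_0^\infty(1\wedge z)\nu(\mathrm{d}z)<\infty$. The branching mechanism is $\Psi(q)=bq+\frac12\sigma^2q^2+\int_0^\infty(e^{-qu}-1+qu)\pi(\mathrm{d}u)$ and the immigration mechanism is $\Phi(q)=\beta q+\int_0^\infty(1-e^{-qu})\nu(\mathrm{d}u)$, $q\ge 0$; it is assumed that $\Phi(q)>0$ for all $q>0$. For $\lambda\ge 0$, $t\mapsto v_t(\lambda)$ solves $\frac{\partial}{\partial t}v_t(\lambda)=-\Psi(v_t(\lambda))$, $v_0(\lambda)=\lambda$. A CBI$(\Psi,\Phi)$ process is a $[0,\infty)$-valued Markov process $(Y_t)$ with $\mathbb E_x[e^{-\lambda Y_t}]=\exp\big(-xv_t(\lambda)-\int_0^t\Phi(v_s(\lambda))\mathrm{d}s\big)$, where $\mathbb E_x$ refers to the process started at $x\ge0$. *)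

(* Defs.v *)
From HB Require Import structures.
From mathcomp Require Import all_boot all_order all_algebra.
From mathcomp Require Import all_classical all_reals all_analysis.
Set Implicit Arguments. Unset Strict Implicit. Unset Printing Implicit Defensive.
Import Order.TTheory GRing.Theory Num.Theory.
Import numFieldNormedType.Exports.
Local Open Scope classical_set_scope.
Local Open Scope ring_scope.

Definition Rpos {R : realType} : set R := `]0, +oo[.

Definition branching {R : realType} (sigma b : R)
  (pi : {measure set R -> \bar R}) (q : R) : R :=
  b * q + 2^-1 * sigma ^+ 2 * q ^+ 2 +
  Rintegral pi Rpos (fun u => expR (- (q * u)) - 1 + q * u).

Definition immigration {R : realType} (beta : R)
  (nu : {measure set R -> \bar R}) (q : R) : R :=
  beta * q + Rintegral nu Rpos (fun u => 1 - expR (- (q * u))).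

Definition is_v_solution {R : realType} (Psi : R -> R) (v : R -> R -> R) : Prop :=
  forall lam : R, 0 <= lam ->
    [/\ v 0 lam = lam,
        v t lam @[t --> 0^'+] --> lam,
        (forall t : R, 0 <= t -> 0 <= v t lam) &
        (forall t : R, 0 < t ->
           derivable (v ^~ lam) t 1 /\ derive1 (v ^~ lam) t = - Psi (v t lam))].

Definition natural_filtration {d} {Omega : measurableType d} {R : realType}
  (Y : R -> Omega -> R) (t : R) : set (set Omega) :=
  <<s [set A | exists r : R, exists B : set R,
          [/\ 0 <= r <= t, measurable B & A = Y r @^-1` B]] >>.

(* (Y_t) under P is a CBI(Psi,Phi) process started at x: nonnegative,
   adapted (each Y_t measurable), Y_0 = x a.s., and Markov w.r.t. its
   natural filtration with transition semigroup characterised by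
   E[e^{-lam Y_{t+s}} | F_t] = exp(- Y_t v_s(lam) - \int_0^s Phi(v_r(lam)) dr). *)
Definition is_CBI {d} {Omega : measurableType d} {R : realType}
  (P : probability Omega R) (Psi Phi : R -> R) (x : R)
  (Y : R -> Omega -> R) : Prop :=
  exists v : R -> R -> R,
  [/\ is_v_solution Psi v,
      (forall t w, 0 <= t -> 0 <= Y t w),
      (forall t, 0 <= t -> measurable_fun setT (Y t)),
      {ae P, forall w, Y 0 w = x} &
      (forall t s lam : R, 0 <= t -> 0 <= s -> 0 <= lam ->
        forall A : set Omega, natural_filtration Y t A ->
          (\int[P]_(w in A) (expR (- (lam * Y (t + s) w)))%:E =
           \int[P]_(w in A)
             (expR (- (Y t w * v s lam)
                    - Rintegral lebesgue_measure `[0, s] (fun r => Phi (v r lam))))%:E)%E)].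

(* Main.v *)
Require Import Defs.
From HB Require Import structures.
From mathcomp Require Import all_boot all_order all_algebra.
From mathcomp Require Import all_classical all_reals all_analysis.
From mathcomp Require Import measurable_realfun ring lra.
Import Order.TTheory GRing.Theory Num.Theory.
Import numFieldNormedType.Exports.
Local Open Scope classical_set_scope.
Local Open Scope ring_scope.
Set Implicit Arguments. Unset Strict Implicit. Unset Printing Implicit Defensive.

(* Write Z n = eta n * Y n along integer times, L for the limit of Z n, q n = eta n and
   I(t, lam) for the integral of Phi(v_r(lam)) over [0, t], so that the Laplace transform
   of Z n at 1 is exp(- x v_n(q n) - I(n, q n)).  Let p = E[exp(- L)] be its limit.
   If p = 0 then L = +oo almost surely.  If p > 0 then I(n, q n) stays bounded, and since
   the integral of Phi / |Psi| diverges at 0 this forces v_n(q n) -> 0: a trajectory ending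
   at eps satisfies v_(n - r) >= eps exp(b r), whatever its starting point, because
   Psi(q) >= b q.  Two consequences follow from v_n(q n) -> 0.
   - Doubling q n changes I(n, q n) by a vanishing amount, since convexity of Psi gives
     v_r(2 q) <= 2 v_r(q), and doubling a small trajectory is a bounded time shift.  Hence
     E[exp(- 2 L)] >= E[exp(- L)] and exp(- L) takes its values in {0, 1}.
   - By the Markov property the conditional Laplace transform given the past of a fixed
     time m has the deterministic limit p.  Applied to the event Z m <= 1, whose
     indicator converges to exp(- L), this gives p = p ^ 2. *)

(** * The branching and immigration mechanisms *)

Section compensated_exponential.
Context {R : realType}.
Implicit Types y c : R.

(** The integrand of the jump part of [Psi], at [y = q * u]. *)
Definition cexp (y : R) : R := expR (- y) - 1 + y.

Lemma onem_expRN_le (y : R) : 1 - expR (- y) <= y.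
Proof. by have := expR_ge1Dx (- y); lra. Qed.

Lemma onem_expRN_ge0 (y : R) : 0 <= y -> 0 <= 1 - expR (- y).
Proof. by move=> y0; rewrite subr_ge0 expR_le1 oppr_le0. Qed.

Lemma cexp0 : cexp 0 = 0.
Proof. by rewrite /cexp oppr0 expR0 subrr addr0. Qed.

Lemma cexp_ge0 y : 0 <= cexp y.
Proof. by have := expR_ge1Dx (- y); rewrite /cexp; lra. Qed.

Lemma cexp_le y : 0 <= y -> cexp y <= y.
Proof. by move=> /onem_expRN_ge0; rewrite /cexp; lra. Qed.

(** From [(1 + y) * expR (- y) <= 1] one gets (1 + y) cexp(y) <= y^2, which is at most (1 + y)
    y^2. *)
Lemma cexp_le_sqr y : 0 <= y -> cexp y <= y ^+ 2.
Proof.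
move=> y0; have h := expR_ge1Dx y; have e0 := expR_gt0 (- y).
have e1 := expRxMexpNx_1 y.
have : (1 + y) * expR (- y) <= 1 by rewrite -[leRHS]e1 ler_wpM2r// ltW.
rewrite /cexp => h1; rewrite leNgt; apply/negP => h2.
have y3 : 0 <= y ^+ 3 by rewrite exprn_ge0.
have : 0 < (1 + y) * (expR (- y) - 1 + y - y ^+ 2) by rewrite mulr_gt0//; lra.
by move: h1 y3; rewrite exprS; lra.
Qed.

Lemma cexp_nd y z : 0 <= y -> y <= z -> cexp y <= cexp z.
Proof.
move=> y0 yz; rewrite /cexp.
have -> : expR (- z) = expR (- y) * expR (- (z - y)) by rewrite -expRD; congr expR; ring.
have := onem_expRN_le (z - y); have : expR (- y) <= 1 by rewrite expR_le1 oppr_le0.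
have := expR_gt0 (- y); set a := expR (- y); set c := expR _ => a0 a1 h.
have d0 : 0 <= z - y by lra.
nra.
Qed.

(** The difference of the two sides is the square of 1 - exp(-y). *)
Lemma cexp_double y : 2 * cexp y <= cexp (2 * y).
Proof.
rewrite /cexp; have -> : expR (- (2 * y)) = expR (- y) ^+ 2.
  by rewrite -expRM_natl; congr expR; ring.
by have := sqr_ge0 (1 - expR (- y)); lra.
Qed.

(** Chord inequality from 0, where [cexp] vanishes: the tangent line of the exponential at -c y is
    evaluated at -y and at 0, and the two bounds are averaged with weights c and 1 - c. *)
Lemma cexp_convex c y : 0 <= c <= 1 -> cexp (c * y) <= c * cexp y.
Proof.
move=> /andP[c0 c1]; rewrite /cexp.
have e0 := expR_gt0 (- (c * y)).
have h1 : expR (- (c * y)) * (1 + (c * y - y)) <= expR (- y).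
  have -> : expR (- y) = expR (- (c * y)) * expR (c * y - y).
    by rewrite -expRD; congr expR; ring.
  by apply: ler_wpM2l; [exact: ltW|exact: expR_ge1Dx].
have h2 : expR (- (c * y)) * (1 + c * y) <= 1.
  rewrite -[leRHS](expRxMexpNx_1 (c * y)) mulrC.
  by apply: ler_wpM2r; [exact: ltW|exact: expR_ge1Dx].
have := ler_wpM2l c0 h1; have d : 0 <= 1 - c by lra.
by have := ler_wpM2l d h2; lra.
Qed.

End compensated_exponential.

(** * Domination tools for integrals against the jump measures *)

Section measure_bounds.
Context {d : measure_display} {T : measurableType d} {R : realType}
  (mu : {measure set T -> \bar R}).

Lemma integrable_ge0 (D : set T) (g : T -> R) : measurable D ->
  measurable_fun D g -> (forall u, D u -> 0 <= g u) ->
  (\int[mu]_(u in D) (g u)%:E < +oo)%E -> mu.-integrable D (EFin \o g).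
Proof.
move=> mD mg g0 goo; apply/integrableP; split; first exact/measurable_EFinP.
rewrite (eq_integral (fun u => (g u)%:E))// => u; rewrite inE => Du /=.
by rewrite ger0_norm ?g0.
Qed.

Lemma ge0_le_integrable (D : set T) (f g : T -> R) : measurable D ->
  measurable_fun D f -> (forall u, D u -> 0 <= f u <= g u) ->
  mu.-integrable D (EFin \o g) -> mu.-integrable D (EFin \o f).
Proof.
move=> mD mf fg; apply: le_integrable => //; first exact/measurable_EFinP.
move=> u /fg /andP[f0 fg'] /=; rewrite lee_fin !ger0_norm//.
exact: le_trans fg'.
Qed.

Lemma integrableZl_EFin (D : set T) (k : R) (f : T -> R) : measurable D ->
  mu.-integrable D (EFin \o f) -> mu.-integrable D (EFin \o (fun u => k * f u)).
Proof.
by move=> mD /(integrableZl mD k); apply: eq_integrable => // u _ /=.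
Qed.

(** Dominated convergence to 0, the pointwise limit being supplied by a rate C(u) / (n + 1). It
    describes both mechanisms at q = 1 / (n + 1); monotonicity or convexity then reaches every
    smaller q. *)
Lemma Rintegral_dominated_small (D : set T) (f : nat -> T -> R)
    (g C : T -> R) (e : R) :
  measurable D -> (forall n, measurable_fun D (f n)) ->
  (forall n u, D u -> 0 <= f n u <= g u) ->
  mu.-integrable D (EFin \o g) ->
  (forall n u, D u -> f n u <= C u / n.+1%:R) -> 0 < e ->
  exists n, Rintegral mu D (f n) <= e.
Proof.
move=> mD mf fg ig fC e0.
have cv : forall u, D u -> f ^~ u @ \oo --> (0 : R).
  move=> u Du; apply: (@squeeze_cvgr _ _ _ _ (cst 0) (fun n => C u / n.+1%:R)).
  - by near=> n => /=; have /andP[-> _] := fg n u Du; rewrite fC.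
  - exact: cvg_cst.
  - rewrite -[X in _ --> X](mulr0 (C u)); apply: cvgMl_tmp; exact: cvg_harmonic.
have ae1 : {ae mu, forall x : T, D x ->
    (EFin \o f n) x @[n --> \oo] --> (cst 0%E x : \bar R)}.
  by apply: aeW => u Du; apply: cvg_EFin; [exact: nearW|exact: cv].
have ae2 : {ae mu, forall x (n : nat), D x ->
    (`|(EFin \o f n) x| <= (EFin \o g) x)%E}.
  apply: aeW => u n Du /=; have /andP[f0 fg'] := fg n u Du.
  by rewrite lee_fin ger0_norm.
have mEf n : measurable_fun D (EFin \o f n) by exact/measurable_EFinP.
have [_ _] := dominated_convergence mD mEf (measurable_cst _) ae1 ig ae2.
rewrite integral0 => /fine_cvgP[_] /cvgrPdist_le /(_ _ e0) [N _ /(_ N (leqnn _))] /=.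
rewrite sub0r normrN => h; exists N; apply: le_trans h.
exact: ler_norm.
Unshelve. all: by end_near.
Qed.

End measure_bounds.

Lemma Rpos_gt0 {R : realType} (u : R) : Rpos u -> 0 < u.
Proof. by rewrite /Rpos /= in_itv/= andbT. Qed.

Lemma measurable_Rpos {R : realType} : measurable (Rpos : set R).
Proof. exact: measurable_itv. Qed.

(** * Finiteness, monotonicity and continuity at 0 of [Phi] *)

Section immigration_mechanism.
Context {R : realType} (beta : R) (nu : {measure set R -> \bar R}).
Hypothesis beta_ge0 : 0 <= beta.
Hypothesis nu_fin : (\int[nu]_(z in Rpos) (Num.min 1 z)%:E < +oo)%E.

Let integrable_min1 : nu.-integrable Rpos (EFin \o (fun z : R => Num.min 1 z)).
Proof.
apply: integrable_ge0 => //; first exact: measurable_Rpos.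
  by apply: measurable_minr.
by move=> u /Rpos_gt0/ltW u0; rewrite le_min ler01.
Qed.

Let measurable_kernel (q : R) D :
  measurable_fun D (fun u : R => 1 - expR (- (q * u))).
Proof.
apply: measurable_funB => //; apply: measurableT_comp => //.
by apply: measurableT_comp => //; apply: measurable_funM.
Qed.

Lemma integrable_immigration (q : R) : 0 <= q ->
  nu.-integrable Rpos (EFin \o (fun u => 1 - expR (- (q * u)))).
Proof.
move=> q0; apply: (@ge0_le_integrable _ _ _ nu Rpos _ (fun u => (1 + q) * Num.min 1 u)) => //.
- exact: measurable_Rpos.
- move=> u /Rpos_gt0 u0; have qu0 : 0 <= q * u by rewrite mulr_ge0// ltW.
  rewrite onem_expRN_ge0//=.
  have := onem_expRN_le (q * u); have := expR_gt0 (- (q * u)).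
  by case: (leP 1 u) => u1; nra.
- exact: (integrableZl_EFin (1 + q) measurable_Rpos integrable_min1).
Qed.

Lemma immigration_nd (p q : R) : 0 <= p -> p <= q ->
  immigration beta nu p <= immigration beta nu q.
Proof.
move=> p0 pq; rewrite /immigration lerD ?ler_wpM2l//; apply: le_Rintegral.
- exact: measurable_Rpos.
- exact: integrable_immigration.
- exact/integrable_immigration/(le_trans p0).
- move=> u /Rpos_gt0 u0; rewrite lerD2l lerN2 ler_expR lerN2.
  by rewrite ler_wpM2r// ltW.
Qed.

Lemma immigration0 : immigration beta nu 0 = 0.
Proof.
rewrite /immigration mulr0 add0r (@eq_Rintegral _ _ _ _ _ (cst 0)).
  by rewrite Rintegral_cst ?mul0r//; exact: measurable_Rpos.
by move=> u _; rewrite mul0r oppr0 expR0 subrr.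
Qed.

Lemma immigration_ge0 (q : R) : 0 <= q -> 0 <= immigration beta nu q.
Proof. by move=> q0; rewrite -immigration0 immigration_nd. Qed.

Lemma immigration_small (e : R) : 0 < e ->
  exists2 d : R, 0 < d & forall q : R, 0 <= q <= d -> immigration beta nu q <= e.
Proof.
move=> e0; have e20 : 0 < e / 2 by lra.
have [n hn] : exists n,
      Rintegral nu Rpos (fun u => 1 - expR (- (n.+1%:R^-1 * u))) <= e / 2.
  apply: (@Rintegral_dominated_small _ _ _ nu Rpos _ (fun u => Num.min 1 u) id) => //.
  - exact: measurable_Rpos.
  - move=> n u /Rpos_gt0 u0.
    have qu0 : 0 <= n.+1%:R^-1 * u by rewrite mulr_ge0// ltW.
    rewrite onem_expRN_ge0//=.
    rewrite le_min lerBlDr lerDl expR_ge0/= (le_trans (onem_expRN_le _))//.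
    by rewrite ler_piMl ?invf_le1 ?ler1n// ltW.
  - by move=> n u _; rewrite (le_trans (onem_expRN_le _))// mulrC.
have b1 : 0 < 2 * (beta + 1) by move: beta_ge0; lra.
(* The first bound controls the jump part; the second makes the drift at most beta e / (2 (beta +
   1)) <= e / 2. *)
exists (Num.min n.+1%:R^-1 (e / (2 * (beta + 1)))).
  by rewrite lt_min invr_gt0 ltr0n/= divr_gt0.
move=> q /andP[q0]; rewrite le_min => /andP[qn qe].
rewrite /immigration [leRHS](_ : e = e / 2 + e / 2); last by field.
rewrite lerD//; first by move: qe; rewrite (ler_pdivlMr _ _ b1); move: beta_ge0; lra.
apply: le_trans hn; apply: le_Rintegral.
- exact: measurable_Rpos.
- exact: integrable_immigration.
- by apply: integrable_immigration; rewrite invr_ge0.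
- move=> u /Rpos_gt0 u0; rewrite lerD2l lerN2 ler_expR lerN2.
  by rewrite ler_wpM2r// ltW.
Qed.

End immigration_mechanism.

(** * Convexity bounds for [Psi] and its slope at 0 *)

Section branching_mechanism.
Context {R : realType} (sigma b : R) (pi : {measure set R -> \bar R}).
Hypothesis b_lt0 : b < 0.
Hypothesis pi_fin : (\int[pi]_(z in Rpos) (Num.min z (z ^+ 2))%:E < +oo)%E.

Let integrable_min2 : pi.-integrable Rpos (EFin \o (fun z : R => Num.min z (z ^+ 2))).
Proof.
apply: integrable_ge0 => //; first exact: measurable_Rpos.
  by apply: measurable_minr.
by move=> u /Rpos_gt0/ltW u0; rewrite le_min u0 sqr_ge0.
Qed.

Let measurable_kernel (c q : R) D :
  measurable_fun D (fun u : R => c * cexp (q * u)).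
Proof.
apply: measurable_funM => //; rewrite /cexp; apply: measurable_funD.
  apply: measurable_funB => //; apply: measurableT_comp => //.
  by apply: measurableT_comp => //; apply: measurable_funM.
by apply: measurable_funM.
Qed.

(** Here cexp(q u) <= min(q u, q^2 u^2), which is at most (q + q^2) min(u, u^2). *)
Let integrable_kernel (c q : R) : 0 <= q ->
  pi.-integrable Rpos (EFin \o (fun u => c * cexp (q * u))).
Proof.
move=> q0; apply: (integrableZl_EFin c measurable_Rpos).
apply: (@ge0_le_integrable _ _ _ pi Rpos _ (fun u => (q + q ^+ 2) * Num.min u (u ^+ 2))) => //.
- exact: measurable_Rpos.
- by under eq_fun do rewrite -(mul1r (cexp _)); exact: measurable_kernel.
- move=> u /Rpos_gt0 u0; have qu0 : 0 <= q * u by rewrite mulr_ge0// ltW.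
  rewrite cexp_ge0/=; have := cexp_le qu0; have := cexp_le_sqr qu0.
  have q20 : 0 <= q ^+ 2 by rewrite sqr_ge0.
  have u20 : 0 <= u ^+ 2 by rewrite sqr_ge0.
  by rewrite exprMn; case: (leP u (u ^+ 2)) => uu; nra.
- exact: (integrableZl_EFin (q + q ^+ 2) measurable_Rpos integrable_min2).
Qed.

Let G (q : R) := Rintegral pi Rpos (fun u => 1 * cexp (q * u)).

Let branchingE (q : R) :
  branching sigma b pi q = b * q + 2^-1 * sigma ^+ 2 * q ^+ 2 + G q.
Proof.
by rewrite /branching; congr (_ + _); apply: eq_Rintegral => u _; rewrite mul1r.
Qed.

(** Beyond its linear part [Psi] is a sum of nondecreasing terms. This one-sided Lipschitz bound
    drives the comparisons of trajectories; with p = 0 it reads Psi(q) >= b q. *)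
Lemma branching_nd (p q : R) : 0 <= p -> p <= q ->
  branching sigma b pi p - b * p <= branching sigma b pi q - b * q.
Proof.
move=> p0 pq; rewrite !branchingE.
have : G p <= G q.
  apply: le_Rintegral.
  - exact: measurable_Rpos.
  - exact: integrable_kernel.
  - exact/integrable_kernel/(le_trans p0).
  - move=> u /Rpos_gt0 u0; have up : 0 <= p * u by rewrite mulr_ge0// ltW.
    rewrite !mul1r cexp_nd//.
    by rewrite ler_wpM2r// ltW.
have : sigma ^+ 2 * p ^+ 2 <= sigma ^+ 2 * q ^+ 2.
  by rewrite ler_wpM2l ?sqr_ge0// ler_sqr ?nnegrE// (le_trans p0).
lra.
Qed.

Lemma branching0 : branching sigma b pi 0 = 0.
Proof.
rewrite branchingE expr0n/= !mulr0 !add0r /G (@eq_Rintegral _ _ _ _ _ (cst 0)).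
  by rewrite Rintegral_cst ?mul0r//; exact: measurable_Rpos.
by move=> u _; rewrite mul0r cexp0 mulr0.
Qed.

(** A trace of convexity: the linear term doubles exactly, the quadratic and jump terms at least
    double. *)
Lemma branching_double (q : R) : 0 <= q ->
  2 * branching sigma b pi q <= branching sigma b pi (2 * q).
Proof.
move=> q0; rewrite !branchingE.
have : 2 * G q <= G (2 * q).
  rewrite -RintegralZl//; [|exact: measurable_Rpos|exact: integrable_kernel].
  apply: le_Rintegral.
  - exact: measurable_Rpos.
  - under eq_fun do rewrite mulrA; exact: integrable_kernel.
  - by apply: integrable_kernel; rewrite mulr_ge0.
  - by move=> u _; rewrite !mul1r -mulrA cexp_double.
have : 0 <= sigma ^+ 2 * q ^+ 2 by rewrite mulr_ge0 ?sqr_ge0.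
rewrite exprMn; lra.
Qed.

(** The slope of [Psi] at 0 is b < 0; near 0 the quadratic and the jump part each use up at most - b
    q / 4. *)
Lemma branching_small : exists2 e : R, 0 < e &
  forall q : R, 0 <= q <= e -> branching sigma b pi q <= b / 2 * q.
Proof.
have bn := b_lt0; have b40 : 0 < - b / 4 by lra.
(* The difference quotient of the jump part at 1 / (n + 1): its integrand is at most min(u, u^2) and
   at most u^2 / (n + 1). *)
have [n hn] : exists n,
      Rintegral pi Rpos (fun u => n.+1%:R * cexp (n.+1%:R^-1 * u)) <= - b / 4.
  apply: (@Rintegral_dominated_small _ _ _ pi Rpos _ (fun u => Num.min u (u ^+ 2))
    (fun u => u ^+ 2)) => //.
  - exact: measurable_Rpos.
  - move=> n u /Rpos_gt0 u0; have n0 : (0 : R) < n.+1%:R by rewrite ltr0n.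
    have qu0 : 0 <= n.+1%:R^-1 * u by rewrite mulr_ge0 ?ltW// invr_gt0.
    rewrite mulr_ge0 ?cexp_ge0//= le_min; apply/andP; split.
      by rewrite mulrC -ler_pdivlMr// [leRHS]mulrC cexp_le.
    rewrite mulrC -ler_pdivlMr// (le_trans (cexp_le_sqr qu0))//.
    rewrite exprMn mulrC ler_wpM2l ?sqr_ge0// expr2 ler_piMl// ?invr_ge0//.
    by rewrite invf_le1 ?ler1n.
  - move=> n u /Rpos_gt0 u0; have n0 : (0 : R) < n.+1%:R by rewrite ltr0n.
    have qu0 : 0 <= n.+1%:R^-1 * u by rewrite mulr_ge0 ?ltW// invr_gt0.
    rewrite mulrC -ler_pdivlMr// (le_trans (cexp_le_sqr qu0))//.
    by rewrite exprMn mulrC (expr2 n.+1%:R^-1) mulrA.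
have n0 : (0 : R) < n.+1%:R by rewrite ltr0n.
(* Below the second bound, sigma^2 q / 2 <= - b / 4; the added 1 covers sigma = 0. *)
exists (Num.min n.+1%:R^-1 (- b / (2 * sigma ^+ 2 + 1))).
  by rewrite lt_min invr_gt0 n0/= divr_gt0//; have := sqr_ge0 sigma; lra.
move=> q /andP[q0]; rewrite le_min => /andP[qn qe].
have s0 := sqr_ge0 sigma.
have Gq : G q <= q * (- b / 4).
  apply: (le_trans _ (ler_wpM2l q0 hn)).
  have in0 : 0 <= n.+1%:R^-1 :> R by rewrite invr_ge0 ltW.
  rewrite -RintegralZl//; [|exact: measurable_Rpos|exact: integrable_kernel].
  apply: le_Rintegral.
  - exact: measurable_Rpos.
  - exact: integrable_kernel.
  - under eq_fun do rewrite mulrA; exact: integrable_kernel.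
  - move=> u /Rpos_gt0 u0; rewrite mul1r mulrA.
    (* As q (n + 1) <= 1, convexity carries the bound from 1 / (n + 1) down to q. *)
    have -> : q * u = (q * n.+1%:R) * (n.+1%:R^-1 * u) by field; lra.
    apply: cexp_convex; rewrite mulr_ge0 ?(ltW n0)//=.
    by move: qn; rewrite -ler_pdivlMr ?div1r.
have : 2^-1 * sigma ^+ 2 * q ^+ 2 <= - b / 4 * q.
  rewrite expr2 mulrA ler_wpM2r//.
  have d0 : 0 < 2 * sigma ^+ 2 + 1 by lra.
  by move: qe; rewrite ler_pdivlMr//; nra.
rewrite branchingE; lra.
Qed.

End branching_mechanism.

(** * Divergence of the immigration rate along geometric sequences *)

Section geometric_divergence.
Context {R : realType} (b : R) (Psi Phi : R -> R).
Hypothesis b_lt0 : b < 0.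
Hypothesis Psi_nd : forall p q : R, 0 <= p -> p <= q -> Psi p - b * p <= Psi q - b * q.
Hypothesis Psi_small : exists2 e : R, 0 < e & forall q : R, 0 <= q <= e -> Psi q <= b / 2 * q.
Hypothesis Phi_nd : forall p q : R, 0 <= p -> p <= q -> Phi p <= Phi q.
Hypothesis Phi_ge0 : forall q : R, 0 <= q -> 0 <= Phi q.

Let mu := @lebesgue_measure R.

(** Monotonicity is known on [0, +oo[ only, so f is first extended to the left by the constant
    f(0). *)
Lemma measurable_fun_nd_ge0 (f : R -> R) (D : set R) :
  (forall p q : R, 0 <= p -> p <= q -> f p <= f q) -> measurable D ->
  D `<=` [set u : R | 0 <= u] -> measurable_fun D f.
Proof.
move=> fnd mD D0; apply: (eq_measurable_fun ((fun u => f (Num.max 0 u)) : R -> R)).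

  by move=> u /set_mem /D0 /= u0; rewrite max_r.
apply: nondecreasing_measurable => // p q pq.
by apply: fnd; [rewrite le_max lexx|rewrite ge_max !le_max lexx pq orbT].
Qed.

(** [Psi] need not be monotone, but it is the sum of the nondecreasing Psi(u) - b u and a linear
    map. *)
Lemma measurable_fun_rate (D : set R) : measurable D -> D `<=` [set u : R | 0 <= u] ->
  measurable_fun D (fun u => Phi u / `|Psi u|).
Proof.
move=> mD D0.
under eq_fun do rewrite -powR_inv1//.
apply: measurable_funM; first exact: measurable_fun_nd_ge0.
apply: (@measurableT_comp _ _ _ _ _ _ (fun x : R => x `^ (-1))).
  exact: measurable_powR.
apply: measurableT_comp => //.
apply: (eq_measurable_fun ((fun u => (Psi u - b * u) + b * u) : R -> R)).

  by move=> u _; rewrite subrK.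
by apply: measurable_funD; [exact: measurable_fun_nd_ge0|apply: measurable_funM].
Qed.

(** The points e exp(b k) decrease to 0; k + 1 is the least index whose point lies below u, and that
    index is not 0 because u < e. *)
Lemma geometric_bracket (e u : R) : 0 < u < e ->
  exists k : nat, e * expR (b * k.+1%:R) < u <= e * expR (b * k%:R).
Proof.
move=> /andP[u0 ue]; have e0 : 0 < e by exact: lt_trans ue.
have ex : exists n : nat, e * expR (b * n%:R) < u.
  exists (Num.bound `|ln (u / e) / b|).
  have /(le_lt_trans (ler_norm _)) := archi_boundP (normr_ge0 (ln (u / e) / b)).
  rewrite ltr_ndivrMr// => h; rewrite mulrC -ltr_pdivlMr//.
  by rewrite -[ltRHS]lnK ?posrE ?divr_gt0// ltr_expR mulrC.
have := ex_minnP ex => -[[|k] hk min].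
  by move: hk; rewrite mulr0 expR0 mulr1 => /(lt_trans ue); rewrite ltxx.
exists k; rewrite hk/= leNgt; apply/negP => /min; by rewrite ltnn.
Qed.

(** Integral test. Bounded sums would bound the integral of Phi / |Psi| near 0: on the geometric
    piece ]X(k+1), X(k)] the integrand is at most Phi(X(k)) times 2 / (- b X(k+1)), and the length
    is proportional to X(k+1). *)
Lemma sum_Phi_unbounded (eps : R) : 0 < eps ->
  (forall e : R, 0 < e -> (\int[mu]_(u in (`]0%R, e[ : set R))
        (Phi u / `|Psi u|)%:E)%E = +oo%E) ->
  forall C : R, exists n : nat, C < \sum_(k < n) Phi (eps * expR (b * k.+1%:R)).
Proof.
move=> eps0 Hdiv C; apply: contrapT => /forallNP H.
have {}H n : \sum_(k < n) Phi (eps * expR (b * k.+1%:R)) <= C.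
  by rewrite leNgt; apply/negP/H.
have [e0 e00 Psi_le] := Psi_small.
(* The bound eps exp(b) gives X(k) <= eps exp(b (k + 1)), the argument in the sum; the bound e0
   gives Psi(u) <= b u / 2 on all pieces. *)
pose e1 := Num.min (eps * expR b) e0.
have e10 : 0 < e1 by rewrite lt_min e00 mulr_gt0// expR_gt0.
pose X k : R := e1 * expR (b * k%:R).
pose A k : set R := `]X k.+1, X k]%classic.
have X0 k : 0 < X k by rewrite mulr_gt0// expR_gt0.
have Xd i j : (i <= j)%N -> X j <= X i.
  move=> ij; rewrite ler_pM2l// ler_expR ler_nM2l ?ler_nat//.
pose c := 2 / (- b) * (expR (- b) - 1).
have mA k : measurable (A k) by exact: measurable_itv.
pose D := \bigcup_k A k.
have mD : measurable D by exact: bigcup_measurable.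
have A0 k : A k `<=` [set u : R | 0 <= u].
  by move=> u; rewrite /A /= in_itv /= => /andP[/(lt_trans (X0 _))/ltW].
have D0 : D `<=` [set u : R | 0 <= u] by move=> u [k _] /A0.
have f0 u : D u -> (0 <= (Phi u / `|Psi u|)%:E)%E.
  by move=> /D0 u0; rewrite lee_fin divr_ge0// Phi_ge0.
have mf (S : set R) : measurable S -> S `<=` [set u : R | 0 <= u] ->
    measurable_fun S (fun u => (Phi u / `|Psi u|)%:E).
  by move=> mS S0; apply/measurable_EFinP; exact: measurable_fun_rate.
have piece k : (\int[mu]_(u in A k) (Phi u / `|Psi u|)%:E <= (c * Phi (X k))%:E)%E.
  pose K := Phi (X k) * (2 / (- b * X k.+1)).
  apply: (@le_trans _ _ (\int[mu]_(u in A k) (cst K%:E) u)%E).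
    apply: ge0_le_integral => //.
    - exact: mA.
    - by move=> u Au; apply: f0; exists k.
    - exact: mf.
    - move=> u; rewrite /A /= in_itv/= => /andP[u1 u2].
      have u0 : 0 < u by exact: lt_trans u1.
      have bn : 0 < - b by rewrite oppr_gt0.
      have ue : u <= e0.
        rewrite (le_trans u2)// (le_trans (Xd 0%N k _))// /X mulr0 expR0 mulr1.
        by rewrite ge_min lexx orbT.
      have P1 : Psi u <= b / 2 * u by apply: Psi_le; rewrite ltW.
      have bu : 0 < - b * X k.+1 by rewrite mulr_gt0.
      have P2 : - b * X k.+1 / 2 <= `|Psi u|.
        rewrite ler0_norm; last by nra.
        by apply: (@le_trans _ _ (- b * u / 2)); [rewrite ler_pM2r// ler_wpM2l// ltW|lra].
      rewrite lee_fin /K; apply: ler_pM => //.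
      + by rewrite Phi_ge0// ltW.
      + by rewrite Phi_nd// ltW.
      + rewrite -[leRHS]invrK invf_div lef_pV2// posrE; last by rewrite divr_gt0.
        by rewrite (lt_le_trans _ P2)// divr_gt0.
  have XX : X k.+1 < X k by rewrite ltr_pM2l// ltr_expR ltr_nM2l// ltr_nat.
  have muA : mu (A k) = (X k - X k.+1)%:E.
    by rewrite /mu /A lebesgue_measure_itv/= lte_fin XX EFinD.
  rewrite integral_cst; last exact: mA.
  rewrite [X in (_ * X)%E]muA -EFinM lee_fin /K.
  have -> : X k = X k.+1 * expR (- b).
    rewrite /X -mulrA -expRD; congr (_ * expR _); rewrite -natr1; ring.
  rewrite le_eqVlt; apply/orP; left; apply/eqP; rewrite /c; field.
  by rewrite (lt_eqF b_lt0) (gt_eqF (X0 _)).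
have PhiX k : Phi (X k) <= Phi (eps * expR (b * k.+1%:R)).
  rewrite Phi_nd ?(ltW (X0 k))// /X.
  have -> : eps * expR (b * k.+1%:R) = eps * expR b * expR (b * k%:R).
    by rewrite -mulrA -expRD; congr (_ * expR _); rewrite -natr1; ring.
  by rewrite ler_wpM2r ?expR_ge0// ge_min lexx.
have c0 : 0 <= c.
  have b0 : 0 <= - b by rewrite oppr_ge0 ltW.
  by rewrite /c mulr_ge0 ?divr_ge0// subr_ge0 -expR0 ler_expR.
(* The divergence on ]0, e1[ is contradicted by the finite bound c C, since the pieces cover this
   interval. *)
have := Hdiv e1 e10; apply/eqP; rewrite lt_eqF//.
apply: (@le_lt_trans _ _ (c * C)%:E); last exact: ltry.
apply: (@le_trans _ _ (\int[mu]_(u in D) (Phi u / `|Psi u|)%:E)%E).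
  apply: ge0_subset_integral => //; first exact: mf.
  move=> u; rewrite /= in_itv /= => /geometric_bracket [k hk].
  by exists k => //; rewrite /A /= in_itv /=.
rewrite ge0_integral_bigcup//; last 2 first.
- exact: mf.
- apply: ltn_trivIset => i j ij; apply/seteqP; split => // u [] /=.
  rewrite /A /= !in_itv/= => /andP[h1 _] /andP[_ h2].
  by have := lt_le_trans h1 (le_trans h2 (Xd _ _ ij)); rewrite ltxx.
apply: (@le_trans _ _ (\sum_(0 <= k <oo) (c * Phi (X k))%:E)%E).
  apply: lee_nneseries => // i _ _; apply: integral_ge0 => u Au.
  by apply: f0; exists i.
apply: lime_le.
  by apply: is_cvg_nneseries => k _ _; rewrite lee_fin mulr_ge0// Phi_ge0// ltW.
apply: nearW => n; rewrite sumEFin lee_fin -mulr_sumr ler_wpM2l//.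
apply: le_trans (H n); rewrite big_mkord; apply: ler_sum => k _; exact: PhiX.
Qed.

End geometric_divergence.

(** * Trajectories of the flow *)

Section paths.
Context {R : realType}.
Implicit Types (f h : R -> R) (r s t : R).

(** The regularity that [is_v_solution] provides: right continuity at the initial time,
    differentiability afterwards. *)
Definition path_from0 f := (f t @[t --> 0^'+] --> f 0) /\
  forall t, 0 < t -> derivable f t 1.

Lemma path_from0_continuous f s t : path_from0 f -> 0 <= s ->
  {within `[s, t], continuous f}.
Proof.
move=> [f0 fd] s0.
have fc (r : R) : 0 < r -> f x @[x --> r] --> f r.
  by move=> /fd /derivable1_diffP /differentiable_continuous.
have [ts|st] := leP t s.
  have ss : `[s, t]%classic `<=` [set s].
    move=> r; rewrite /= in_itv/= => /andP[sr rt].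
    by apply/eqP; rewrite eq_le sr (le_trans rt).
  apply: (continuous_subspaceW ss); exact: continuous_subspace1.
apply/continuous_within_itvP => //; split.
- by move=> r; rewrite in_itv/= => /andP[sr _]; exact/fc/(le_lt_trans s0).
- have [<-//|s_neq0] := eqVneq 0 s.
  by apply: cvg_at_right_filter; apply: fc; rewrite lt_neqAle s_neq0.
- by apply: cvg_at_left_filter; apply: fc; exact: le_lt_trans st.
Qed.

Lemma path_from0N f : path_from0 f -> path_from0 (- f).
Proof.
by move=> [f0 fd]; split; [exact: cvgN|move=> t /fd; exact: derivableN].
Qed.

(** f(r) exp(- k r) is nonincreasing. Both k and f may have any sign, so the bound also applies to
    the opposite of a trajectory. *)
Lemma gronwall_le f k s t : path_from0 f -> 0 <= s -> s <= t ->
  (forall r, s < r < t -> derive1 f r <= k * f r) ->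
  f t <= f s * expR (k * (t - s)).
Proof.
move=> pf s0 st fk.
pose E (r : R) := expR (- (k * r)).
have dE (r : R) : is_derive r (1 : R) E (E r * (- k)).
  rewrite /E; apply: is_derive_eq; rewrite /GRing.scale /= ; ring.
have cE : continuous E.
  by move=> r; apply/differentiable_continuous/derivable1_diffP/ex_derive.
have dg (r : R) : 0 < r -> is_derive r (1 : R) (f \* E) (E r * (derive1 f r - k * f r)).
  move=> r0; have df : is_derive r (1 : R) f (derive1 f r).
    by rewrite derive1E; apply/derivableP/(proj2 pf).
  apply: is_derive_eq; rewrite /GRing.scale/=; ring.
have pg : path_from0 (f \* E).
  split; last by move=> r /dg[].
  by apply: cvgM; [exact: (proj1 pf)|apply: cvg_at_right_filter; exact: cE].
have H : (f \* E) t <= (f \* E) s.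
  apply: (@ler0_derive1_le_cc _ (f \* E) s t) => //.
  - by move=> r; rewrite in_itv/= => /andP[/(le_lt_trans s0)/dg[]].
  - move=> r; rewrite in_itv/= => srt; have /andP[sr _] := srt.
    have D := dg r (le_lt_trans s0 sr).
    rewrite derive1E derive_val mulr_ge0_le0 ?expR_ge0// subr_le0; exact: fk.
  - exact: path_from0_continuous.
  - by rewrite in_itv/= st lexx.
  - by rewrite in_itv/= st lexx.
move: H; rewrite /= /E => H.
have -> : expR (k * (t - s)) = expR (k * t) * expR (- (k * s)).
  by rewrite -expRD; congr expR; ring.
rewrite mulrCA mulrC -ler_pdivrMr ?expR_gt0// -expRN mulrC.
by rewrite mulrC.
Qed.

(** The differential inequality is available only where h > 0. Were h(t) > 0, Gronwall from the last
    time at which h <= 0 would give h(t) <= 0. *)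
Lemma comparison h K s t : path_from0 h -> 0 <= s -> s <= t -> h s <= 0 ->
  (forall r, s < r < t -> 0 < h r -> derive1 h r <= K * h r) -> h t <= 0.
Proof.
move=> ph s0 st hs hK; rewrite leNgt; apply/negP => ht.
pose S := [set r : R | s <= r <= t /\ h r <= 0].
have Ss : S s by rewrite /S /= lexx st.
have Sub : ubound S t by move=> r [/andP[]].
have hsup : has_sup S by split; [exists s|exists t].
have supt : sup S <= t by apply: ge_sup => //; exists s.
have ssup : s <= sup S by apply: ub_le_sup => //; exists t.
have hgt (r : R) : sup S < r <= t -> 0 < h r.
  move=> /andP[Sr rt]; rewrite ltNge; apply/negP => hr.
  have : r <= sup S.
    apply: ub_le_sup; first by exists t.
    by rewrite /S /= rt (le_trans ssup (ltW Sr)).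
  by rewrite leNgt Sr.
(* A positive value at the supremum would persist to its left, where times of [S] accumulate; the
   supremum then exceeds s, so h is continuous there. *)
have hsup0 : h (sup S) <= 0.
  rewrite leNgt; apply/negP => hS.
  have S0 : s < sup S.
    rewrite lt_neqAle ssup andbT; apply/eqP => E; move: hS; rewrite -E.
    by rewrite ltNge hs.
  have /derivable1_diffP/differentiable_continuous hc :=
    proj2 ph _ (le_lt_trans s0 S0).
  have /cvgrPdist_lt /(_ _ hS) := hc.
  move=> [e /= e0 He].
  have [r [/andP[sr rt] hr]] := sup_adherent e0 hsup.
  move=> rS; have rle : r <= sup S by apply: ub_le_sup => //; [exists t|split => //; rewrite sr].
  have := He r; rewrite /ball/= ger0_norm ?subr_ge0//.
  have h1 : sup S - r < e by lra.
  move=> /(_ h1); rewrite ltr_norml => /andP[_]; lra.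
have := @gronwall_le h K (sup S) t ph (le_trans s0 ssup) supt.
move=> H; have : h t <= h (sup S) * expR (K * (t - sup S)).
  apply: H => r /andP[r1 r2]; apply: hK; first by rewrite (le_lt_trans ssup).
  by rewrite hgt// r1 ltW.
move=> /(lt_le_trans ht); rewrite pmulr_lgt0 ?expR_gt0//.
by rewrite ltNge hsup0.
Qed.

End paths.

(** * Growth, doubling and small values of solutions of w' = - Psi(w) *)

Section trajectories.
Context {R : realType} (b : R) (Psi : R -> R).
Hypothesis b_lt0 : b < 0.
Hypothesis Psi_nd : forall p q : R, 0 <= p -> p <= q -> Psi p - b * p <= Psi q - b * q.
Hypothesis Psi0 : Psi 0 = 0.
Hypothesis Psi_double : forall q : R, 0 <= q -> 2 * Psi q <= Psi (2 * q).

(** The initial value is left free, so that flow lines from different starting points can be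
    compared. *)
Definition trajectory (w : R -> R) := [/\ path_from0 w, forall t : R, 0 <= t -> 0 <= w t
  & forall t : R, 0 < t -> derive1 w t = - Psi (w t)].

Lemma trajectory_growth w s t : trajectory w -> 0 <= s -> s <= t ->
  w t <= w s * expR (- b * (t - s)).
Proof.
move=> [pw w0 dw] s0 st; apply: gronwall_le => // r /andP[sr _].
have r0 : 0 < r by exact: le_lt_trans sr.
have := Psi_nd (lexx 0) (w0 r (ltW r0)); rewrite Psi0 dw// mulr0 subr0.
by rewrite mulNr; lra.
Qed.

(** Growth read backwards: the past of a trajectory is bounded below by its terminal value alone,
    whatever the starting point. *)
Lemma trajectory_backward w s t : trajectory w -> 0 <= s -> s <= t ->
  w t * expR (b * (t - s)) <= w s.
Proof.
move=> tw s0 st; have := trajectory_growth tw s0 st.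
by rewrite mulNr expRN ler_pdivlMr ?expR_gt0.
Qed.

(** For h = w2 - 2 w, convexity gives h' <= Psi(2 w) - Psi(w2), which is at most - b h where h > 0;
    comparison applies. *)
Lemma trajectory_double w w2 t : trajectory w -> trajectory w2 -> w2 0 = 2 * w 0 ->
  0 <= t -> w2 t <= 2 * w t.
Proof.
move=> [pw w0 dw] [pw2 w20 dw2] e0 t0.
pose h := (fun r : R => w2 r - 2 * w r).
have dh (r : R) : 0 < r -> is_derive r (1 : R) h (- Psi (w2 r) + 2 * Psi (w r)).
  move=> r0.
  have d1 : is_derive r (1 : R) w (- Psi (w r)).
    by rewrite -dw// derive1E; apply/derivableP/(proj2 pw).
  have d2 : is_derive r (1 : R) w2 (- Psi (w2 r)).
    by rewrite -dw2// derive1E; apply/derivableP/(proj2 pw2).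
  rewrite /h; apply: is_derive_eq; rewrite /GRing.scale/=; ring.
have ph : path_from0 h.
  split; last by move=> r /dh[].
  by apply: cvgB; [exact: (proj1 pw2)|apply: cvgMl_tmp; exact: (proj1 pw)].
have : h t <= 0.
  apply: (@comparison _ h (- b) 0) => //; first by rewrite /h e0 subrr.
  move=> r /andP[r0 _] hr; have D := dh r r0.
  rewrite derive1E derive_val.
  have w0r : 0 <= 2 * w r by rewrite mulr_ge0// w0// ltW.
  have ww : 2 * w r <= w2 r by move: hr; rewrite /h; lra.
  have := Psi_nd w0r ww; have := Psi_double (w0 r (ltW r0)).
  rewrite /h; lra.
by rewrite /h; lra.
Qed.

Section small.
Variable e : R.
Hypothesis Psi_small : forall q : R, 0 <= q <= e -> Psi q <= b / 2 * q.

(** Below e a trajectory does not decrease, as Psi <= 0 there; so one that is at or above e cannot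
    drop below it later. *)
Lemma trajectory_lt w s t : trajectory w -> 0 <= s -> s <= t -> w t < e -> w s < e.
Proof.
move=> [pw w0 dw] s0 st; rewrite !ltNge; apply: contra => ews.
pose h := (fun r : R => e - w r).
have dh (r : R) : 0 < r -> is_derive r (1 : R) h (Psi (w r)).
  move=> r0.
  have d1 : is_derive r (1 : R) w (- Psi (w r)).
    by rewrite -dw// derive1E; apply/derivableP/(proj2 pw).
  rewrite /h; apply: is_derive_eq; ring.
have ph : path_from0 h.
  split; last by move=> r /dh[].
  by apply: cvgB; [exact: cvg_cst|exact: (proj1 pw)].
suff : h t <= 0 by rewrite /h; lra.
apply: (@comparison _ h 0 s) => //; first by rewrite /h; lra.
move=> r /andP[sr _] hr; have r0 := le_lt_trans s0 sr; have D := dh r r0.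
rewrite derive1E derive_val mul0r.
have wr : 0 <= w r <= e by rewrite w0 ?ltW//=; move: hr; rewrite /h; lra.
apply: le_trans (Psi_small wr) _.
by move: wr => /andP[wr0 _]; move: b_lt0 => b0; nra.
Qed.

(** While below e, w' >= - (b / 2) w, and Gronwall is applied to - w. The bound at the later time t
    keeps w below e on all of [r, s]. *)
Lemma trajectory_growth_small w r s t : trajectory w -> 0 <= r -> r <= s -> s <= t ->
  w t < e -> w r * expR (- b / 2 * (s - r)) <= w s.
Proof.
move=> tw r0 rs st wt; have [pw w0 dw] := tw.
have := @gronwall_le _ (- w) (- b / 2) r s (path_from0N pw) r0 rs.
rewrite !opprfctE !mulNr lerN2; apply=> u /andP[ru us]; have u0 := le_lt_trans r0 ru.
rewrite derive1E (@deriveN _ _ _ w); last exact: (proj2 pw).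
rewrite -derive1E dw// opprK mulrNN.
apply: Psi_small; rewrite w0 ?(ltW u0)//= ltW//.
exact: (trajectory_lt tw (ltW u0) (le_trans (ltW us) st)).
Qed.

End small.
End trajectories.

(** * Immigration accumulated along a trajectory *)

Lemma lebesgue_itv_lty {R : realType} (s t : R) (x y : bool) :
  (lebesgue_measure [set` Interval (BSide x s) (BSide y t)] < +oo)%E.
Proof. by rewrite lebesgue_measure_itv/=; case: ifP => // _; rewrite -EFinD ltry. Qed.

Section integral_increment.
Context {R : realType} (F : R -> R) (t : R).
Notation mu := (@lebesgue_measure R).
Hypothesis iF : mu.-integrable `[0, t] (EFin \o F).

Let J (s : R) := Rintegral mu `[0, s] F.

Let itvS (s : R) : 0 <= s -> s <= t -> mu.-integrable `]s, t] (EFin \o F).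
Proof.
move=> s0 st; apply: integrableS iF => //; apply: subset_itvr.
by rewrite bnd_simp.
Qed.

Let J_increment (s : R) : 0 <= s -> s <= t -> J t - J s = Rintegral mu `]s, t] F.
Proof.
by move=> s0 st; apply: (@Rintegral_itvB _ F (BLeft 0) (BRight t) s); rewrite ?bnd_simp.
Qed.

Let Jcst (s c : R) : s <= t -> Rintegral mu `]s, t] (cst c) = c * (t - s).
Proof.
move=> st; have mE : mu `]s, t]%classic = (t - s)%:E.
  rewrite lebesgue_measure_itv/= lte_fin.
  move: st; rewrite le_eqVlt => /predU1P[->|st]; first by rewrite ltxx subrr.
  by rewrite st -EFinD.
by rewrite Rintegral_cst// [X in fine X]mE.
Qed.

Let icst (s c : R) : mu.-integrable `]s, t] (EFin \o cst c).
Proof.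
apply: measurable_bounded_integrable => //.
  exact: lebesgue_itv_lty.
exact: bounded_cst.
Qed.

Lemma Rintegral_increment_ge (s c : R) : 0 <= s -> s <= t ->
  (forall r : R, s < r <= t -> c <= F r) ->
  J s + c * (t - s) <= J t.
Proof.
move=> s0 st cF; rewrite addrC -lerBrDr J_increment// -Jcst//.
by apply: (le_Rintegral _ (icst s c) (itvS s0 st)) => // r; rewrite /= in_itv/=; exact: cF.
Qed.

Lemma Rintegral_increment_le (s c : R) : 0 <= s -> s <= t ->
  (forall r : R, s < r <= t -> F r <= c) ->
  J t <= J s + c * (t - s).
Proof.
move=> s0 st cF; rewrite addrC -lerBlDr J_increment// -Jcst//.
by apply: (le_Rintegral _ (itvS s0 st) (icst s c)) => // r; rewrite /= in_itv/=; exact: cF.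
Qed.

End integral_increment.

Section immigration_along.
Context {R : realType} (b : R) (Psi Phi : R -> R).
Hypothesis b_lt0 : b < 0.
Hypothesis Psi_nd : forall p q : R, 0 <= p -> p <= q -> Psi p - b * p <= Psi q - b * q.
Hypothesis Psi0 : Psi 0 = 0.
Hypothesis Psi_double : forall q : R, 0 <= q -> 2 * Psi q <= Psi (2 * q).
Hypothesis Phi_nd : forall p q : R, 0 <= p -> p <= q -> Phi p <= Phi q.
Hypothesis Phi_ge0 : forall q : R, 0 <= q -> 0 <= Phi q.
Notation mu := (@lebesgue_measure R).

Definition immig_along (w : R -> R) (t : R) : R :=
  Rintegral mu `[0, t] (fun r => Phi (w r)).

Let integrable_Phi_flow w t : trajectory Psi w ->
  mu.-integrable `[0, t] (EFin \o (fun r => Phi (w r))).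
Proof.
move=> tw; have [pw w0 dw] := tw.
have mw : measurable_fun `[0, t] w.
  by apply: subspace_continuous_measurable_fun => //; exact: path_from0_continuous.
apply: measurable_bounded_integrable => //.
- exact: lebesgue_itv_lty.
- have mpos : measurable [set u : R | 0 <= u].
    have -> : [set u : R | 0 <= u] = `[0, +oo[%classic.
      by apply/seteqP; split=> u /=; rewrite in_itv/= andbT.
    exact: measurable_itv.
  apply: (eq_measurable_fun (Phi \o (fun r => Num.max 0 (w r)))).
    move=> r /set_mem; rewrite /= in_itv/= => /andP[r0 _].
    by rewrite max_r// w0.
  apply: (measurable_comp (F := [set u : R | 0 <= u])) => //.
  + by move=> _ [r _ <-] /=; rewrite le_max lexx.
  + exact: measurable_fun_nd_ge0.
  + exact: measurable_maxr.
- exists (Phi (w 0 * expR (- b * t))); split; first exact: num_real.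
  move=> M PM r; rewrite /= in_itv/= => /andP[r0 rt].
  rewrite ger0_norm; last exact/Phi_ge0/w0.
  apply: ltW; apply: le_lt_trans PM; apply: Phi_nd; first exact: w0.
  have := trajectory_growth Psi_nd Psi0 tw (lexx 0) r0; rewrite subr0 => /le_trans; apply.
  by rewrite ler_wpM2l ?w0// ler_expR ler_wpM2l// oppr_ge0 ltW.
Qed.

Lemma immig_along_nd w s t : trajectory Psi w -> 0 <= s -> s <= t ->
  immig_along w s <= immig_along w t.
Proof.
move=> tw s0 st; have [_ w0 _] := tw.
have := @Rintegral_increment_ge _ _ _ (integrable_Phi_flow t tw) s 0 s0 st.
rewrite mul0r addr0; apply => r /andP[sr _]; apply/Phi_ge0/w0.
by rewrite ltW// (le_lt_trans s0).
Qed.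

(** On ]j, j + 1] the trajectory is at least eps exp(b (n - j)) by the backward bound, so each unit
    of time contributes one term of the sum, the last unit giving k = 0. *)
Lemma immig_along_ge_sum w (eps : R) n : trajectory Psi w -> 0 <= eps -> eps <= w n%:R ->
  \sum_(k < n) Phi (eps * expR (b * k.+1%:R)) <= immig_along w n%:R.
Proof.
move=> tw eps0 epsw; have [_ w0 _] := tw.
have H j : (j <= n)%N ->
    \sum_(k < j) Phi (eps * expR (b * (n - k)%:R)) <= immig_along w j%:R.
  elim: j => [_|j IH jn].
    rewrite big_ord0; apply: Rintegral_ge0 => r; rewrite /= in_itv/= => /andP[r0 _].
    exact/Phi_ge0/w0.
  rewrite big_ord_recr/=; apply: le_trans (lerD (IH (ltnW jn)) (lexx _)) _.
  have jj : (j%:R : R) <= j.+1%:R by rewrite ler_nat.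
  have := @Rintegral_increment_ge _ _ _ (integrable_Phi_flow j.+1%:R tw) j%:R
    (Phi (eps * expR (b * (n - j)%:R))) (ler0n _ _) jj.
  have -> : j.+1%:R - j%:R = 1 :> R by rewrite -natr1 addrAC subrr add0r.
  rewrite mulr1; apply => r /andP[jr rj].
  have r0 : 0 <= r by rewrite (le_trans (ler0n _ j))// ltW.
  have rn : r <= n%:R by rewrite (le_trans rj)// ler_nat.
  apply: Phi_nd; first by rewrite mulr_ge0// expR_ge0.
  apply: le_trans (trajectory_backward Psi_nd Psi0 tw r0 rn).
  apply: ler_pM => //; rewrite ?expR_ge0// ler_expR ler_wnM2l ?ltW//.
  by rewrite natrB 1?ltnW// ltrD2l ltrN2.
apply: le_trans (H n (leqnn n)); rewrite le_eqVlt; apply/orP; left; apply/eqP.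
(* The sum counts time backwards from n, the index k standing for n - 1 - j. *)
rewrite (reindex_inj rev_ord_inj)/=; apply: eq_bigr => k _.
by rewrite subnSK.
Qed.

Section small.
Variable e : R.
Hypothesis Psi_small : forall q : R, 0 <= q <= e -> Psi q <= b / 2 * q.

Lemma trajectory_nd_small w s t : trajectory Psi w -> 0 <= s -> s <= t ->
  w t < e -> w s <= w t.
Proof.
move=> tw s0 st wt; have [_ w0 _] := tw.
apply: le_trans (trajectory_growth_small b_lt0 Psi_small tw s0 st (lexx t) wt).
rewrite ler_peMr ?w0// -expR0 ler_expR mulr_ge0 ?subr_ge0//.
by rewrite mulr_ge0// oppr_ge0 ltW.
Qed.

Lemma immig_along_window w s t : trajectory Psi w -> 0 <= s -> s <= t ->
  w t < e -> immig_along w t <= immig_along w s + Phi (w t) * (t - s).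
Proof.
move=> tw s0 st wt; have [_ w0 _] := tw.
apply: (Rintegral_increment_le (integrable_Phi_flow t tw)) => // r /andP[sr rt].
have r0 : 0 <= r by rewrite (le_trans s0)// ltW.
by apply: Phi_nd; [exact: w0|exact: trajectory_nd_small].
Qed.

(* In the region where [Psi q <= b q / 2] a trajectory doubles within a bounded time, so
   doubling the initial value costs at most a time shift by [m + 1]. *)
Lemma immig_along_double w w2 m n : trajectory Psi w -> trajectory Psi w2 ->
  w2 0 = 2 * w 0 -> 2 <= expR (- b / 2 * m%:R) -> (m.+1 <= n)%N -> w n%:R < e ->
  immig_along w2 n%:R <= immig_along w n%:R + Phi (2 * w n%:R) * m.+1%:R.
Proof.
move=> tw tw2 ww m2 mn wn; have [_ w0 _] := tw; have [_ w20 _] := tw2.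
have n0 k : 0 <= k%:R :> R by exact: ler0n.
(* For r in ]j, j + 1], w2(r) <= 2 w(r) <= w(j + m + 1): the doubling takes time m, and the extra
   unit makes one bound serve the whole interval. *)
have H j : (j + m.+1 <= n)%N -> immig_along w2 j%:R <= immig_along w (j + m.+1)%:R.
  elim: j => [_|j IH jn].
    rewrite [leLHS](_ : _ = 0).
      by apply: Rintegral_ge0 => r; rewrite /= in_itv/= => /andP[r0 _]; exact/Phi_ge0/w0.
    by rewrite /immig_along set_itv1 Rintegral_set1.
  have jn' : (j + m.+1 <= n)%N by apply: leq_trans jn; rewrite addSn.
  pose c := Phi (w (j + m.+1)%:R).
  have jj k : (k%:R : R) <= k.+1%:R by rewrite ler_nat.
  have E k : (k.+1%:R - k%:R = 1 :> R) by rewrite -natr1 addrAC subrr add0r.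
  apply: (@le_trans _ _ (immig_along w2 j%:R + c)).
    have := @Rintegral_increment_le _ _ _ (integrable_Phi_flow j.+1%:R tw2) j%:R c
      (n0 j) (jj j).
    rewrite E mulr1; apply => r /andP[jr rj].
    have r0 : 0 <= r by rewrite (le_trans (n0 j))// ltW.
    have rm : r <= (j + m.+1)%:R by rewrite (le_trans rj)// ler_nat addnS ltnS leq_addr.
    have nn : (j + m.+1)%:R <= n%:R :> R by rewrite ler_nat.
    apply: Phi_nd; first exact: w20.
    apply: le_trans (trajectory_double Psi_nd Psi_double tw tw2 ww r0) _.
    apply: le_trans (trajectory_growth_small b_lt0 Psi_small tw r0 rm nn wn).
    rewrite mulrC ler_wpM2l ?w0// (le_trans m2)// ler_expR ler_wpM2l//.
      by rewrite mulr_ge0// oppr_ge0 ltW.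
    by move: rj; rewrite -addSnnS natrD; lra.
  have := @Rintegral_increment_ge _ _ _ (integrable_Phi_flow (j.+1 + m.+1)%:R tw)
    (j + m.+1)%:R c (n0 _) (jj _).
  rewrite addSn E mulr1 => K; apply: le_trans (lerD (IH jn') (lexx c)) _.
  apply: K => r /andP[jr rj]; apply: Phi_nd; first exact: w0.
  have rn : r <= n%:R by rewrite (le_trans rj)// ler_nat.
  apply: (trajectory_nd_small tw) => //; first exact: ltW.
  apply: (le_lt_trans _ wn); apply: (trajectory_nd_small tw) => //.
  by rewrite (le_trans (n0 (j + m.+1)%N))// ltW.
have nm : (n - m.+1 + m.+1 <= n)%N by rewrite subnK.
have nm0 : (n - m.+1)%:R <= n%:R :> R by rewrite ler_nat leq_subr.
(* The last m + 1 units of time, which the shift does not reach, cost at most Phi(2 w(n)) each. *)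
have K : immig_along w2 n%:R <=
    immig_along w2 (n - m.+1)%:R + Phi (2 * w n%:R) * m.+1%:R.
  have -> : m.+1%:R = n%:R - (n - m.+1)%:R :> R by rewrite natrB// opprB addrC subrK.
  apply: (Rintegral_increment_le (integrable_Phi_flow n%:R tw2)) => // r /andP[jr rj].
  have r0 : 0 <= r by rewrite (le_trans (n0 (n - m.+1)%N))// ltW.
  apply: Phi_nd; first exact: w20.
  apply: le_trans (trajectory_double Psi_nd Psi_double tw tw2 ww r0) _.
  by rewrite ler_wpM2l//; exact: trajectory_nd_small.
apply: le_trans K _; rewrite lerD2r; have := H _ nm; rewrite subnK//.
Qed.

End small.
End immigration_along.

(** * Limits along the normalising sequence *)

Lemma cvgn_shift {R : realType} (f : nat -> R) (l : R) (m : nat) :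
  f n @[n --> \oo] --> l -> f (n + m)%N @[n --> \oo] --> l.
Proof. by rewrite -(@cvg_shiftn m R f (nbhs l)). Qed.

Lemma cvgn_unshift {R : realType} (f : nat -> R) (l : R) (m : nat) :
  f (n + m)%N @[n --> \oo] --> l -> f n @[n --> \oo] --> l.
Proof. by rewrite -[X in _ -> X](@cvg_shiftn m R f (nbhs l)). Qed.

Section flow_limits.
Context {R : realType} (b : R) (Psi Phi : R -> R).
Hypothesis b_lt0 : b < 0.
Hypothesis Psi_nd : forall p q : R, 0 <= p -> p <= q -> Psi p - b * p <= Psi q - b * q.
Hypothesis Psi0 : Psi 0 = 0.
Hypothesis Psi_double : forall q : R, 0 <= q -> 2 * Psi q <= Psi (2 * q).
Hypothesis Psi_small : exists2 e : R, 0 < e &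
  forall q : R, 0 <= q <= e -> Psi q <= b / 2 * q.
Hypothesis Phi_nd : forall p q : R, 0 <= p -> p <= q -> Phi p <= Phi q.
Hypothesis Phi_ge0 : forall q : R, 0 <= q -> 0 <= Phi q.
Hypothesis Phi_small : forall e : R, 0 < e ->
  exists2 d : R, 0 < d & forall q : R, 0 <= q <= d -> Phi q <= e.
Hypothesis Phi_sum : forall eps : R, 0 < eps -> forall C : R, exists n : nat,
  C < \sum_(k < n) Phi (eps * expR (b * k.+1%:R)).

Variables (v : R -> R -> R) (x : R) (q : nat -> R) (p : R).
Hypothesis v_traj : forall lam : R, 0 <= lam -> trajectory Psi (v ^~ lam).
Hypothesis v_init : forall lam : R, 0 <= lam -> v 0 lam = lam.
Hypothesis x_ge0 : 0 <= x.
Hypothesis q_ge0 : forall n, 0 <= q n.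
Hypothesis p_gt0 : 0 < p.

Notation I t lam := (immig_along Phi (v ^~ lam) t).
Hypothesis cvg_p :
  expR (- (x * v n%:R (q n)) - I n%:R (q n)) @[n --> \oo] --> p.

Lemma v_ge0 t lam : 0 <= t -> 0 <= lam -> 0 <= v t lam.
Proof. by move=> t0 /v_traj[_ + _]; apply. Qed.

(** As p > 0, I(n, q n) is eventually below - ln(p / 2). A terminal value above eps would make it
    exceed a partial sum chosen larger than that. *)
Lemma terminal_cvg0 : v n%:R (q n) @[n --> \oo] --> (0 : R).
Proof.
apply/cvgrPdist_le => eps eps0.
have [N hN] := Phi_sum eps0 (- ln (p / 2)).
have p2 : 0 < p / 2 by rewrite divr_gt0.
have ev : \forall n \near \oo, p / 2 < expR (- (x * v n%:R (q n)) - I n%:R (q n)).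
  by apply: (cvgr_gt _ cvg_p); rewrite ltr_pdivrMr// ltr_pMr// ltr1n.
near=> n; rewrite sub0r normrN ger0_norm ?v_ge0// leNgt; apply/negP => epsv.
have h : p / 2 < expR (- (x * v n%:R (q n)) - I n%:R (q n)) by near: n.
move: h; rewrite -[X in X < _ -> _]lnK ?posrE// ltr_expR => h.
have xv : 0 <= x * v n%:R (q n) by rewrite mulr_ge0// v_ge0.
have := immig_along_ge_sum b_lt0 Psi_nd Psi0 Phi_nd Phi_ge0 (v_traj (q_ge0 n))
  (ltW eps0) (ltW epsv).
have Nn : (N <= n)%N by near: n; exact: nbhs_infty_ge.
have : \sum_(k < N) Phi (eps * expR (b * k.+1%:R)) <=
       \sum_(k < n) Phi (eps * expR (b * k.+1%:R)).
  rewrite -!(big_mkord predT (fun k => Phi (eps * expR (b * k.+1%:R)))).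
  rewrite (big_cat_nat _ Nn)//= lerDl sumr_ge0// => k _.
  by apply: Phi_ge0; rewrite mulr_ge0 ?expR_ge0// ltW.
by move=> h1 h2; lra.
Unshelve. all: by end_near.
Qed.

Lemma Phi_cvg0 (u : nat -> R) : (forall n, 0 <= u n) -> u n @[n --> \oo] --> (0 : R) ->
  Phi (u n) @[n --> \oo] --> (0 : R).
Proof.
move=> u0 uc; apply/cvgrPdist_le => eps eps0.
have [d d0 hd] := Phi_small eps0.
near=> n; rewrite sub0r normrN ger0_norm ?Phi_ge0// hd// u0/= ltW//.
by near: n; apply: (cvgr_lt _ uc).
Unshelve. all: by end_near.
Qed.

(** Here y stands for the value of the process at time m. As the terminal values vanish, neither x
    nor y affects the limit, and shortening the horizon by m costs at most m Phi(v_(n+m)) -> 0. *)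
Lemma shifted_cvg (m : nat) (y : R) :
  expR (- (y * v n%:R (q (n + m)%N)) - I n%:R (q (n + m)%N)) @[n --> \oo] --> p.
Proof.
have [e e0 Psi_e] := Psi_small.
have vc : v (n + m)%:R (q (n + m)%N) @[n --> \oo] --> (0 : R).
  exact: (cvgn_shift m terminal_cvg0).
have nn n : n%:R <= (n + m)%:R :> R by rewrite ler_nat leq_addr.
have small : \forall n \near \oo, v (n + m)%:R (q (n + m)%N) < e.
  exact: (cvgr_lt _ vc).
have vc' : v n%:R (q (n + m)%N) @[n --> \oo] --> (0 : R).
  apply: (@squeeze_cvgr _ _ _ _ (cst 0) (fun n => v (n + m)%:R (q (n + m)%N))) => //.
    near=> n; rewrite v_ge0//=.
    by apply: (trajectory_nd_small b_lt0 Psi_e (v_traj (q_ge0 _))) => //; near: n.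
  exact: cvg_cst.
have dI : I (n + m)%:R (q (n + m)%N) - I n%:R (q (n + m)%N) @[n --> \oo] --> (0 : R).
  apply: (@squeeze_cvgr _ _ _ _ (cst 0) (fun n => Phi (v (n + m)%:R (q (n + m)%N)) * m%:R)).
  - near=> n; rewrite subr_ge0 (immig_along_nd b_lt0 Psi_nd Psi0 Phi_nd Phi_ge0)//=;
      last exact: v_traj.
    rewrite lerBlDl.
    have := immig_along_window b_lt0 Psi_nd Psi0 Phi_nd Phi_ge0 Psi_e
      (v_traj (q_ge0 (n + m)%N)) (ler0n _ n) (nn n).
    have -> : (n + m)%:R - n%:R = m%:R :> R by rewrite natrD addrAC subrr add0r.
    by apply; near: n.
  - exact: cvg_cst.
  - rewrite -[X in _ --> X](mul0r m%:R); apply: cvgMr_tmp; apply: Phi_cvg0 => // n; exact: v_ge0.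
rewrite [X in _ --> X](_ : p = p * expR 0); last by rewrite expR0 mulr1.
(* The convergent sequence, shifted by m, times the exponential of a vanishing correction. *)
have E n : expR (- (y * v n%:R (q (n + m)%N)) - I n%:R (q (n + m)%N)) =
    expR (- (x * v (n + m)%:R (q (n + m)%N)) - I (n + m)%:R (q (n + m)%N))
    * expR (x * v (n + m)%:R (q (n + m)%N) - y * v n%:R (q (n + m)%N)
      + (I (n + m)%:R (q (n + m)%N) - I n%:R (q (n + m)%N))).
  by rewrite -expRD; congr expR; ring.
rewrite (eq_cvg _ _ E).
apply: cvgM.
  exact: (cvgn_shift m cvg_p).
apply: continuous_cvg; first exact: continuous_expR.
rewrite [X in _ --> X](_ : 0 = x * 0 - y * 0 + 0); last by ring.
by apply: cvgD => //; apply: cvgB; apply: cvgMl_tmp.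
Unshelve. all: by end_near.
Qed.

(** The doubled transform is bounded below by [E n], of limit p: doubling q n at most doubles v_n
    and raises I by at most (m + 1) Phi(2 v_n). *)
Lemma double_limit_ge (l : R) :
  expR (- (x * v n%:R (2 * q n)) - I n%:R (2 * q n)) @[n --> \oo] --> l -> p <= l.
Proof.
move=> cl; have [e e0 Psi_e] := Psi_small.
have vc := terminal_cvg0.
(* m is a time in which a trajectory staying below e at least doubles. *)
have [m m2] : exists m : nat, 2 <= expR (- b / 2 * m%:R).
  have bn : 0 < - b / 2 by rewrite divr_gt0// oppr_gt0.
  exists (Num.bound (ln 2 / (- b / 2))).
  have l0 : 0 <= ln 2 / (- b / 2) :> R by rewrite divr_ge0 ?ln_ge0 ?ler1n// ltW.
  have := archi_boundP l0; rewrite ltr_pdivrMr// => /ltW h.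
  by rewrite -[leLHS]lnK ?posrE// ler_expR mulrC.
have small : \forall n \near \oo, v n%:R (q n) < e by exact: (cvgr_lt _ vc).
have q20 n : 0 <= 2 * q n by rewrite mulr_ge0.
pose E n := expR (- (x * v n%:R (q n)) - I n%:R (q n)) *
  expR (- (x * v n%:R (q n)) - Phi (2 * v n%:R (q n)) * m.+1%:R).
have Ec : E n @[n --> \oo] --> p.
  rewrite [X in _ --> X](_ : p = p * expR 0); last by rewrite expR0 mulr1.
  apply: cvgM => //.
  apply: continuous_cvg; first exact: continuous_expR.
  rewrite [X in _ --> X](_ : 0 = - (x * 0) - 0 * m.+1%:R); last by ring.
  apply: cvgB; first by apply: cvgN; apply: cvgMl_tmp.
  apply: cvgMr_tmp; apply: Phi_cvg0; first by move=> n; rewrite mulr_ge0// v_ge0.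
  by rewrite -[X in _ --> X](mulr0 2); apply: cvgMl_tmp.
apply: (ler_cvg_to Ec cl); near=> n.
have tq := v_traj (q_ge0 n); have tq2 := v_traj (q20 n).
have vv : v 0 (2 * q n) = 2 * v 0 (q n) by rewrite !v_init.
have small_n : v n%:R (q n) < e by near: n.
have mn : (m.+1 <= n)%N by near: n; exact: nbhs_infty_ge.
have h1 := immig_along_double b_lt0 Psi_nd Psi0 Psi_double Phi_nd Phi_ge0
  Psi_e tq tq2 vv m2 mn small_n.
have h2 := trajectory_double Psi_nd Psi_double tq tq2 vv (ler0n _ n).
rewrite /E -expRD ler_expR.
have := ler_wpM2l x_ge0 h2; lra.
Unshelve. all: by end_near.
Qed.

End flow_limits.

(** * A zero-one law for exponential limits *)

Lemma exp_limit_cases {R : realType} (z : nat -> R) (L : \bar R) :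
  (forall n, 0 <= z n) -> (z n)%:E @[n --> \oo] --> L ->
  (exists r : R, [/\ 0 <= r, L = r%:E, z n @[n --> \oo] --> r &
     expR (- z n) @[n --> \oo] --> expR (- r)]) \/
  [/\ L = +oo%E, expR (- z n) @[n --> \oo] --> (0 : R) & \forall n \near \oo, 1 < z n].
Proof.
move=> z0; case: L => [r||] zL.
- left; exists r.
  have zr : z n @[n --> \oo] --> r by have [_] := (fine_cvgP _ _).1 zL.
  split => //; first by apply: (cvgr_to_ge zr); exact: nearW.
  by apply: continuous_cvg; [exact: continuous_expR|exact: cvgN].
- right; have zy : z n @[n --> \oo] --> +oo by apply/cvgeryP.
  split => //; last by move/cvgryPgt : zy; exact.
  exact: (cvg_comp _ _ zy (@cvgr_expR R)).
- have : (0 <= -oo :> \bar R)%E by apply: (cvge_ge _ zL); apply: nearW => n; rewrite lee_fin.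
  by rewrite leNgt ltNy0.
Qed.

Section probability_lemmas.
Context {d : measure_display} {Omega : measurableType d} {R : realType}
  (P : probability Omega R).

Lemma bounded_integrable (f : Omega -> R) (A : set Omega) : measurable A ->
  measurable_fun A f -> (forall w, 0 <= f w <= 1) -> P.-integrable A (EFin \o f).
Proof.
move=> mA mf f01; apply: measurable_bounded_integrable => //.
  exact: le_lt_trans (probability_le1 P mA) (ltry _).
exists 1; split; first exact: num_real.
move=> M M1 w _; have /andP[f0 f1] := f01 w.
by rewrite /= ger0_norm// (le_trans f1)// ltW.
Qed.

Lemma bounded_cvg_Rintegral (f : nat -> Omega -> R) (g : Omega -> R) (A : set Omega) :
  measurable A -> (forall n, measurable_fun A (f n)) -> measurable_fun A g ->
  (forall n w, 0 <= f n w <= 1) ->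
  {ae P, forall w, f n w @[n --> \oo] --> g w} ->
  Rintegral P A (f n) @[n --> \oo] --> Rintegral P A g.
Proof.
move=> mA mf mg f01 fg.
have ig : P.-integrable A (EFin \o cst 1).
  by apply: bounded_integrable => // w; rewrite /= ler01 lexx.
have mEf n : measurable_fun A (EFin \o f n) by exact/measurable_EFinP.
have mEg : measurable_fun A (EFin \o g) by exact/measurable_EFinP.
have ae1 : {ae P, forall w, A w -> (EFin \o f n) w @[n --> \oo] --> ((EFin \o g) w : \bar R)}.
  by apply: filterS fg => w fgw _; apply: cvg_EFin => //; exact: nearW.
have ae2 : {ae P, forall w (n : nat), A w -> (`|(EFin \o f n) w| <= (EFin \o cst 1%R) w)%E}.
  apply: aeW => w n _ /=; have /andP[f0 f1] := f01 n w.
  by rewrite lee_fin ger0_norm.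
have [i _ c] := dominated_convergence mA mEf mEg ae1 ig ae2.
have ie : (\int[P]_(x in A) (EFin \o g) x = (Rintegral P A g)%:E)%E.
  by rewrite /Rintegral fineK//; exact: integrable_fin_num.
by move: c; rewrite ie => /fine_cvgP[].
Qed.

Lemma Rintegral_eq0_ae (f : Omega -> R) : measurable_fun setT f ->
  (forall w, 0 <= f w <= 1) -> Rintegral P setT f = 0 -> {ae P, forall w, f w = 0}.
Proof.
move=> mf f01 f0.
have i := bounded_integrable measurableT mf f01.
have mEf : measurable_fun setT (EFin \o f) by exact/measurable_EFinP.
have : (\int[P]_(w in setT) `|(EFin \o f) w| = 0)%E.
  rewrite (eq_integral (EFin \o f)); last first.
    by move=> w _ /=; rewrite ger0_norm//; have /andP[] := f01 w.
  rewrite -[LHS]fineK; first by rewrite [fine _]f0.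
  exact: integrable_fin_num.
move=> /(ae_eq_integral_abs P measurableT mEf).
by apply: filterS => w /(_ Logic.I) [].
Qed.

Section zero_one.
Variable Z : nat -> Omega -> R.
Hypothesis Z_ge0 : forall n w, 0 <= Z n w.
Hypothesis mZ : forall n, measurable_fun setT (Z n).
Hypothesis Z_cvg : {ae P, forall w, exists L : \bar R, (Z n w)%:E @[n --> \oo] --> L}.
(** What the branching structure has to supply: asymptotic independence of exp(- Z n) from the event
    Z m <= 1, and then the effect of doubling the normalisation. *)
Hypothesis Z_indep : forall p : R, 0 < p ->
  Rintegral P setT (fun w => expR (- Z n w)) @[n --> \oo] --> p ->
  forall m, Rintegral P (Z m @^-1` `]-oo, 1]) (fun w => expR (- Z n w)) @[n --> \oo] -->
    p * fine (P (Z m @^-1` `]-oo, 1])).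
Hypothesis Z_double : forall p : R, 0 < p ->
  Rintegral P setT (fun w => expR (- Z n w)) @[n --> \oo] --> p ->
  forall l : R, Rintegral P setT (fun w => expR (- (2 * Z n w))) @[n --> \oo] --> l -> p <= l.

(** A measurable version of exp(- L), defined for every w as a limsup; the clamping gives values in
    [0, 1] also off the set of convergence. *)
Let g (w : Omega) : R :=
  Num.max 0 (Num.min 1 (fine (limn_esup (fun n => (expR (- Z n w))%:E)))).

Let mexp (c : R) n A : measurable A ->
  measurable_fun A (fun w => expR (- (c * Z n w))).
Proof.
move=> mA; apply: (@measurable_funS _ _ _ _ setT) => //.
apply: measurableT_comp => //; apply: measurableT_comp => //.
by apply: measurable_funM.
Qed.

Let mexp1 n A : measurable A -> measurable_fun A (fun w => expR (- Z n w)).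
Proof. by move=> /(mexp 1 n); under eq_fun do rewrite mul1r. Qed.

Let mg : measurable_fun setT g.
Proof.
apply: measurable_maxr => //; apply: measurable_minr => //.
apply: measurableT_comp => //; apply: measurable_fun_limn_esup => n.
exact/measurable_EFinP/mexp1.
Qed.

Let g01 w : 0 <= g w <= 1.
Proof. by rewrite /g le_max lexx/= ge_max ler01 ge_min lexx. Qed.

Let exp01 (y : R) : 0 <= y -> 0 <= expR (- y) <= 1.
Proof. by move=> y0; rewrite expR_ge0 expR_le1 oppr_le0. Qed.

Let g_lim w (l : R) : 0 <= l <= 1 -> expR (- Z n w) @[n --> \oo] --> l -> g w = l.
Proof.
move=> /andP[l0 l1] el.
have El : (expR (- Z n w))%:E @[n --> \oo] --> l%:E by apply: cvg_EFin => //; exact: nearW.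
rewrite /g is_cvg_limn_esupE; last by apply/cvg_ex; exists l%:E.
by rewrite (cvg_lim _ El)//= min_r// max_r.
Qed.

Let ae_g : {ae P, forall w, (exists r : R, [/\ 0 <= r, Z n w @[n --> \oo] --> r,
     g w = expR (- r) & expR (- Z n w) @[n --> \oo] --> g w]) \/
  [/\ (Z n w)%:E @[n --> \oo] --> +oo%E, g w = 0, expR (- Z n w) @[n --> \oo] --> g w
    & \forall n \near \oo, 1 < Z n w]}.
Proof.
apply: filterS Z_cvg => w [L ZL].
have [[r [r0 _ zr er]]|[Ly e0 z1]] := exp_limit_cases (Z_ge0 ^~ w) ZL.
  by left; exists r; rewrite (g_lim (exp01 r0) er).
by right; rewrite (@g_lim w 0)// -?Ly// lexx ler01.
Qed.

Let cvg_exp A : measurable A ->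
  Rintegral P A (fun w => expR (- Z n w)) @[n --> \oo] --> Rintegral P A g.
Proof.
move=> mA; apply: bounded_cvg_Rintegral => //.
- by move=> n; exact: mexp1.
- exact: measurable_funS mg.
- by move=> n w; exact: exp01.
- by apply: filterS ae_g => w [[r []]|[]].
Qed.

Let p := Rintegral P setT g.

Let p_ge0 : 0 <= p.
Proof. by apply: Rintegral_ge0 => w _; have /andP[] := g01 w. Qed.

Let sqr_g01 w : 0 <= g w ^+ 2 <= 1.
Proof.
have /andP[g0 g1] := g01 w.
by rewrite sqr_ge0/= expr2 mulr_ile1.
Qed.

Let ig : P.-integrable setT (EFin \o g).
Proof. exact: bounded_integrable. Qed.

Let msqr : measurable_fun setT (fun w => g w ^+ 2).
Proof. exact: measurable_funX. Qed.

Let isqr : P.-integrable setT (EFin \o (fun w => g w ^+ 2)).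
Proof. exact: bounded_integrable. Qed.

(** Doubling gives E[g^2] >= E[g], while g^2 <= g pointwise. *)
Let g_idem : 0 < p -> {ae P, forall w, g w - g w ^+ 2 = 0}.
Proof.
move=> p0; apply: Rintegral_eq0_ae.
- exact: measurable_funB.
- move=> w; have /andP[g0 g1] := g01 w; have /andP[s0 s1] := sqr_g01 w.
  by apply/andP; split; [rewrite expr2; nra|lra].
have pE := @Z_double p p0 (cvg_exp measurableT) (Rintegral P setT (fun w => g w ^+ 2)).
rewrite RintegralB//; apply/eqP; rewrite eq_le; apply/andP; split.
  rewrite subr_le0; apply: pE; apply: bounded_cvg_Rintegral => //.
  - by move=> n; exact: mexp.
  - by move=> n w; apply: exp01; rewrite mulr_ge0.
  - have E n w : expR (- (2 * Z n w)) = expR (- Z n w) ^+ 2.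
      by rewrite -expRM_natl; congr expR; ring.
    apply: filterS ae_g => w H; rewrite (eq_cvg _ _ (E ^~ w)).
    have {}H : expR (- Z n w) @[n --> \oo] --> g w by case: H => [[r []]|[]].
    by rewrite expr2; under eq_cvg do rewrite expr2; exact: cvgM.
rewrite subr_ge0; apply: le_Rintegral => // w _.
have /andP[g0 g1] := g01 w; rewrite expr2; nra.
Qed.

Lemma zero_one_limit :
  {ae P, forall w, Z n w @[n --> \oo] --> (0 : R)} \/
  {ae P, forall w, (Z n w)%:E @[n --> \oo] --> +oo%E}.
Proof.
have [p0|p0] := eqVneq p 0.
  right; have g0 := Rintegral_eq0_ae mg g01 p0.
  apply: filterS2 ae_g g0 => w [[r [_ _ -> _]]|[]//].
  by move=> /eqP; rewrite expR_eq0.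
left; have pp : 0 < p by rewrite lt_neqAle eq_sym p0 p_ge0.
pose A m := Z m @^-1` `]-oo, 1%R].
have mA m : measurable (A m) by rewrite -[A m]setTI; apply: mZ.
(* An idempotent exp(- r) forces r = 0, so the limits are 0 or +oo and the threshold 1 separates
   them. *)
have gA : {ae P, forall w, (\1_(A n) w : R) @[n --> \oo] --> g w}.
  apply: filterS2 ae_g (g_idem pp) => w [[r [r0 zr gr _]]|[_ g0 _ z1]] gg.
    have r00 : r = 0.
      have : expR (- r) = 1.
        have gn0 : g w != 0 by rewrite gr expR_eq0.
        by rewrite -gr; apply: (mulfI gn0); rewrite mulr1 -expr2; lra.
      by rewrite -expR0 => /expR_inj/eqP; rewrite oppr_eq0 => /eqP.
    rewrite gr r00 oppr0 expR0; apply: cvg_near_cst.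
    have z1 : \forall n \near \oo, Z n w < 1 by apply: (cvgr_lt _ zr); rewrite r00 ltr01.
    apply: filterS z1 => n zn; rewrite indicE mem_set//= /A /= in_itv/=; exact: ltW.
  rewrite g0; apply: cvg_near_cst; apply: filterS z1 => n zn.
  by rewrite indicE memNset// /A /= in_itv/= => zn1; move: zn; rewrite ltNge zn1.
have mind m : measurable_fun setT (\1_(A m) : Omega -> R) by exact: measurable_indic.
have ind01 m w : 0 <= (\1_(A m) w : R) <= 1.
  by rewrite indicE; case: (_ \in _); rewrite /= ?lexx ?ler01.
have PA m : fine (P (A m)) = Rintegral P setT (\1_(A m)).
  by rewrite /Rintegral integral_indic// setIT.
have c1 : fine (P (A m)) @[m --> \oo] --> p.
  rewrite (eq_cvg _ _ PA); exact: bounded_cvg_Rintegral.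
(* Two expressions for the limit of E[exp(- Z n); Z m <= 1] as n grows, m being fixed. *)
have gAm m : p * fine (P (A m)) = Rintegral P setT (fun w => g w * \1_(A m) w).
  have -> : p * fine (P (A m)) = Rintegral P (A m) g.
    apply: (cvg_unique (@Rhausdorff R) (@Z_indep p pp (cvg_exp measurableT) m)).
    exact: (cvg_exp (mA m)).
  rewrite Rintegral_mkcond; apply: eq_Rintegral => w _.
  by rewrite patchE indicE; case: (_ \in _); rewrite ?mulr1 ?mulr0.
have gg : Rintegral P setT (fun w => g w * g w) = p.
  have : Rintegral P setT (fun w => g w - g w ^+ 2) = 0.
    rewrite /Rintegral (ae_eq_integral (cst 0%E)) ?integral0//.
      by apply/measurable_EFinP; exact: measurable_funB.
    by apply: filterS (g_idem pp) => w gw _ /=; rewrite gw.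
  rewrite RintegralB// => /eqP; rewrite subr_eq0 => /eqP.
  by rewrite -/p => ->; apply: eq_Rintegral => w _; rewrite expr2.
have c2 : p * fine (P (A m)) @[m --> \oo] --> p.
  rewrite -[X in _ --> X]gg (eq_cvg _ _ gAm); apply: bounded_cvg_Rintegral => //.
  - by move=> n; exact: measurable_funM.
  - move=> n w; have /andP[g0 g1] := g01 w; have /andP[i0 i1] := ind01 n w.
    by rewrite mulr_ge0//= mulr_ile1.
  - by apply: filterS gA => w gw; apply: cvgMl_tmp.
(* Letting m grow, p P(A m) tends both to p p and to p. *)
have p1 : p = 1.
  have c3 : p * fine (P (A m)) @[m --> \oo] --> p * p by apply: cvgMl_tmp.
  have E : p * p = p by apply: (cvg_unique (@Rhausdorff R) c3 c2).
  by apply: (mulfI p0); rewrite E mulr1.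
have : {ae P, forall w, 1 - g w = 0}.
  apply: Rintegral_eq0_ae.
  - exact: measurable_funB.
  - by move=> w; have /andP[g0 g1] := g01 w; apply/andP; split; lra.
  - rewrite RintegralB//; last by apply: bounded_integrable => // w; rewrite ler01 lexx.
    by rewrite Rintegral_cst// [X in fine X]probability_setT/= mulr1 -/p p1 subrr.
apply: filterS2 ae_g => w [[r [r0 zr gr _]]|[_ g0 _ _]] g1; last first.
  by move: g1; rewrite g0 subr0 => /eqP; rewrite oner_eq0.
have r00 : r = 0.
  have : expR (- r) = expR 0 by rewrite -gr expR0; lra.
  by move=> /expR_inj/eqP; rewrite oppr_eq0 => /eqP.
by rewrite -[X in _ --> X]r00.
Qed.

End zero_one.
End probability_lemmas.

(** * CBI processes *)

Lemma is_v_solution_trajectory {R : realType} (Psi : R -> R) (v : R -> R -> R) (lam : R) :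
  is_v_solution Psi v -> 0 <= lam -> trajectory Psi (v ^~ lam).
Proof.
move=> vs lam0; have [v0 vc vge vd] := vs lam lam0; split => //.
- by split; [rewrite v0|move=> t /vd[]].
- by move=> t /vd[].
Qed.

(** The mechanisms enter only through the inequalities established above, and time is restricted to
    integers so that dominated convergence for sequences applies. *)
Lemma CBI_sequence_zero_one {d : measure_display} {Omega : measurableType d} {R : realType}
  (P : probability Omega R) (b x : R) (Psi Phi : R -> R) (Y : R -> Omega -> R) (eta : R -> R) :
  b < 0 ->
  (forall p q : R, 0 <= p -> p <= q -> Psi p - b * p <= Psi q - b * q) ->
  Psi 0 = 0 ->
  (forall q : R, 0 <= q -> 2 * Psi q <= Psi (2 * q)) ->
  (exists2 e : R, 0 < e & forall q : R, 0 <= q <= e -> Psi q <= b / 2 * q) ->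
  (forall p q : R, 0 <= p -> p <= q -> Phi p <= Phi q) ->
  (forall q : R, 0 <= q -> 0 <= Phi q) ->
  (forall e : R, 0 < e -> exists2 d : R, 0 < d & forall q : R, 0 <= q <= d -> Phi q <= e) ->
  (forall eps : R, 0 < eps -> forall C : R, exists n : nat,
    C < \sum_(k < n) Phi (eps * expR (b * k.+1%:R))) ->
  0 <= x -> is_CBI P Psi Phi x Y -> (forall t, 0 <= t -> 0 < eta t) ->
  {ae P, forall w, exists L : \bar R, (eta n%:R * Y n%:R w)%:E @[n --> \oo] --> L} ->
  {ae P, forall w, eta n%:R * Y n%:R w @[n --> \oo] --> (0 : R)} \/
  {ae P, forall w, (eta n%:R * Y n%:R w)%:E @[n --> \oo] --> +oo%E}.
Proof.
move=> b0 Psi_nd Psi0 Psi_double Psi_small Phi_nd Phi_ge0 Phi_small Phi_sum x0.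
move=> [v [vs Y0 mY Yx markov]] eta0 Zc.
have v_traj lam : 0 <= lam -> trajectory Psi (v ^~ lam) by exact: is_v_solution_trajectory.
have v_init lam : 0 <= lam -> v 0 lam = lam by move=> /vs[].
pose q n : R := eta n%:R.
have q0 n : 0 <= q n by rewrite ltW// eta0.
have mZ n : measurable_fun setT (fun w => eta n%:R * Y n%:R w).
  by apply: measurable_funM => //; exact: mY.
have I0 t lam : 0 <= t -> 0 <= lam -> 0 <= immig_along Phi (v ^~ lam) t.
  move=> t0 lam0; apply: Rintegral_ge0 => r; rewrite /= in_itv/= => /andP[r0 _].
  exact/Phi_ge0/(v_ge0 v_traj).
have FT : natural_filtration Y 0 setT.
  by apply: sub_gen_smallest; exists 0, setT; rewrite lexx preimage_setT.
(* The Markov property at time 0 on the whole space, where Y_0 = x almost surely. *)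
have laplace lam n : 0 <= lam ->
    Rintegral P setT (fun w => expR (- (lam * Y n%:R w))) =
    expR (- (x * v n%:R lam) - immig_along Phi (v ^~ lam) n%:R).
  move=> lam0; have := markov 0 n%:R lam (lexx 0) (ler0n _ n) lam0 setT FT.
  rewrite add0r /Rintegral => ->.
  set c := expR _.
  transitivity (Rintegral P setT (cst c)).
    congr fine; apply: ae_eq_integral => //.
    - apply/measurable_EFinP; apply: measurableT_comp => //; apply: measurable_funB => //.
      by apply: measurableT_comp => //; apply: measurable_funM => //; exact: mY.
    - exact: (@measurable_cst _ _ _ _ setT c%:E).
    - by apply: filterS Yx => w Yw _ /=; rewrite Yw.
  by rewrite Rintegral_cst// [X in fine X]probability_setT mulr1.
apply: (@zero_one_limit _ _ _ P (fun n w => eta n%:R * Y n%:R w)) => //.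
- by move=> n w; rewrite mulr_ge0 ?Y0// ltW// eta0.
- move=> p p0 cp m; set A := _ @^-1` _.
  have mA : measurable A by rewrite -[A]setTI; apply: mZ.
  have FA : natural_filtration Y m%:R A.
    apply: sub_gen_smallest; exists m%:R, ((fun y => eta m%:R * y) @^-1` `]-oo, 1%R]).
    split; [by rewrite ler0n lexx| |by []].
    by rewrite -[X in measurable X]setTI; apply: measurable_funM.
  have cp' : expR (- (x * v n%:R (q n)) - immig_along Phi (v ^~ (q n)) n%:R) @[n --> \oo] --> p.
    by rewrite -(eq_cvg _ _ (fun n => laplace (q n) n (q0 n))).
  (* The index is shifted by m so that n is the time elapsed since m in the Markov property. *)
  apply: (@cvgn_unshift R _ _ m).
  have E n : Rintegral P A (fun w => expR (- (eta (n + m)%:R * Y (n + m)%:R w))) =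
      Rintegral P A (fun w => expR (- (Y m%:R w * v n%:R (q (n + m)%N))
        - immig_along Phi (v ^~ (q (n + m)%N)) n%:R)).
    have := markov m%:R n%:R (q (n + m)%N) (ler0n _ m) (ler0n _ n) (q0 _) A FA.
    by rewrite -natrD addnC /Rintegral /q => ->.
  rewrite (eq_cvg _ _ E) -(Rintegral_cst P mA p).
  apply: bounded_cvg_Rintegral => //.
  + move=> n; apply: (@measurable_funS _ _ _ _ setT) => //.
    apply: measurableT_comp => //; apply: measurable_funB => //.
    by apply: measurableT_comp => //; apply: measurable_funM => //; exact: mY.
  + move=> n w; rewrite expR_ge0/= expR_le1 subr_le0.
    apply: (@le_trans _ _ 0); last exact: I0.
    by rewrite oppr_le0 mulr_ge0 ?Y0// (v_ge0 v_traj).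
  (* For each w the conditional transform, with y = Y_m(w), tends to the same constant p. *)
  + by apply: aeW => w; exact: (shifted_cvg b0 Psi_nd Psi0 Psi_small Phi_nd Phi_ge0
      Phi_small Phi_sum v_traj x0 q0 p0 cp').
- move=> p p0 cp l cl.
  have cp' : expR (- (x * v n%:R (q n)) - immig_along Phi (v ^~ (q n)) n%:R) @[n --> \oo] --> p.
    by rewrite -(eq_cvg _ _ (fun n => laplace (q n) n (q0 n))).
  apply: (double_limit_ge b0 Psi_nd Psi0 Psi_double Psi_small Phi_nd Phi_ge0 Phi_small
    Phi_sum v_traj v_init x0 q0 p0 cp').
  have q20 n : 0 <= 2 * q n by rewrite mulr_ge0.
  rewrite -(eq_cvg _ _ (fun n => laplace (2 * q n) n (q20 n))).
  have E n : Rintegral P setT (fun w => expR (- (2 * q n * Y n%:R w))) =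
      Rintegral P setT (fun w => expR (- (2 * (eta n%:R * Y n%:R w)))).
    by apply: eq_Rintegral => w _; rewrite -mulrA.
  by rewrite (eq_cvg _ _ E).
Qed.

Theorem theorem3 (R : realType) (sigma b beta : R)
  (pi nu : {measure set R -> \bar R})
  (d : measure_display) (Omega : measurableType d) (P : probability Omega R)
  (x : R) (Y : R -> Omega -> R) (eta : R -> R) :
  0 <= sigma -> b < 0 -> 0 <= beta ->
  sigma_finite Rpos pi -> sigma_finite Rpos nu ->
  (\int[pi]_(z in Rpos) (Num.min z (z ^+ 2))%:E < +oo)%E ->
  (\int[nu]_(z in Rpos) (Num.min 1 z)%:E < +oo)%E ->
  (forall q : R, 0 < q -> 0 < immigration beta nu q) ->
  (forall eps : R, 0 < eps ->
     (\int[lebesgue_measure]_(u in (`]0%R, eps[ : set R))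
        (immigration beta nu u / `|branching sigma b pi u|)%:E)%E = +oo%E) ->
  0 <= x ->
  is_CBI P (branching sigma b pi) (immigration beta nu) x Y ->
  (forall t, 0 <= t -> 0 < eta t) ->
  {ae P, forall w, exists L : \bar R,
      ((eta t * Y t w)%:E @[t --> +oo] --> L)} ->
  {ae P, forall w, (eta t * Y t w)%:E @[t --> +oo] --> 0%E} \/
  {ae P, forall w, (eta t * Y t w)%:E @[t --> +oo] --> +oo%E}.
Proof.
move=> _ b0 beta0 _ _ pi_fin nu_fin _ div x0 cbi eta0 cv.
have seq w (L : \bar R) : (eta t * Y t w)%:E @[t --> +oo] --> L ->
    (eta n%:R * Y n%:R w)%:E @[n --> \oo] --> L.
  have ny : n%:R @[n --> \oo] --> (+oo : set_system R) by apply/cvgrnyP.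
  exact: cvg_comp ny.
have Psi_nd := branching_nd sigma b pi_fin.
have Psi_small := branching_small sigma b0 pi_fin.
have Phi_nd := immigration_nd beta0 nu_fin.
have Phi_ge0 := immigration_ge0 beta0 nu_fin.
have := CBI_sequence_zero_one b0 Psi_nd (branching0 sigma b pi)
  (branching_double sigma b pi_fin) Psi_small Phi_nd Phi_ge0
  (immigration_small beta0 nu_fin)
  (fun _ e0 => sum_Phi_unbounded b0 Psi_nd Psi_small Phi_nd Phi_ge0 e0 div) x0 cbi eta0.
case.
- by apply: filterS cv => w [L /seq HL]; exists L.
- move=> H; left; apply: filterS2 cv H => w [L HL] Z0.
  (* The limit over real times exists by assumption, so its value can be read off at integer
     times. *)
  have <- : L = 0%E.
    apply: (cvg_unique (@ereal_hausdorff R) (seq _ _ HL)).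
    by apply: cvg_EFin Z0; exact: nearW.
  exact: HL.
- move=> H; right; apply: filterS2 cv H => w [L HL] Zy.
  by rewrite -(cvg_unique (@ereal_hausdorff R) (seq _ _ HL) Zy).
Qed.
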